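(* Let $(W,S)$ be an arbitrary Coxeter system with $S$ finite, with root system $\Phi$, Coxeter diagram $\Gamma$, and associated oriented matroid $M_\Phi$ (oriented with respect to the fundamental chamber). Then the face poset of the coarse subdivision of the positive Bergman complex $\mathcal{B}^+(M_\Phi)$ is dual (anti-isomorphic) to the face poset of the graph associahedron $P(\Gamma)$.
   Context: Coxeter system: a group $W$ with finite generating set $S$ subject only to relations $(ss')^{m(s,s')}=1$, where $m(s,s)=1$ and $m(s,s')=m(s',s)\in\{2,3,\dots\}\cup\{\infty\}$ for $s\neq s'$ ($\infty$ meaning no relation). The Coxeter diagram $\Gamma$ is the graph on vertex set $S$ with an edge $s$–$s'$ whenever $m(s,s')\ge 3$ (edge labels are irrelevant here; only the underlying simple graph is used). Geometric representation: $V=\mathbb{R}^{S}$ with basis of simple roots $\Delta=\{\alpha_s\}_{s\in S}$, bilinear form $(\alpha_s,\alpha_{s'})=-\cos(\pi/m(s,s'))$ (equal to $-1$ if $m=\infty$), and $s(v)=v-2(v,\alpha_s)\alpha_s$; this is a faithful representation of $W$. Roots: $\Phi=\{w(\alpha_s):w\in W,s\in S\}$; positive roots $\Phi^+$ are the roots with all coefficients in the basis $\Delta$ nonnegative; $\Phi=\Phi^+\sqcup(-\Phi^+)$. $M_\Phi$ is the oriented matroid of the vector configuration $\Phi^+\subset V$ (ground set $\Phi^+$, possibly countably infinite, rank $|S|$); its covectors are the sign vectors $(\mathrm{sign}\, f(\alpha))_{\alpha\in\Phi^+}$ for $f\in V^*$. A flat is positive if it is the zero set of a covector all of whose entries are $+$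 or $0$. For $J\subseteq S$, $W_J$ is the subgroup generated by $J$ and $\Phi^+_J$ is the set of positive roots in the span of $\{\alpha_s:s\in J\}$. A parabolic flat is a set $w\Phi_J^+$ with $J\subseteq S$ and $w$ of minimal length in $wW_J$; throughout, ''flat'' of $M_\Phi$ means parabolic flat (when $W$ is finite every flat is parabolic). For a flag $\mathcal{F}:\emptyset=F_0\subsetneq F_1\subsetneq\cdots\subsetneq F_k\subsetneq F_{k+1}=E$ of flats of a matroid $M$ on ground set $E$, let $M_{\mathcal{F}}=\bigoplus_{i=1}^{k+1}F_i/F_{i-1}$, where $F_i/F_{i-1}$ is the matroid on $F_i\setminus F_{i-1}$ obtained from the restriction of $M$ to $F_i$ by contracting $F_{i-1}$. Positive Bergman complex and its coarse subdivision: $\mathcal{B}^+(M_\Phi)$ is the geometric realization of the order complex of the poset of positive (parabolic) flats with the bottom $\emptyset$ and top $\Phi^+$ removed; each flag of positive flats with $k\ge1$ gives an open simplex (fine cell). Two flags $\mathcal{F},\mathcal{F}'$ are equivalent if $M_{\mathcal{F}}=M_{\mathcal{F}'}$; a coarse cell is the union of the open simplices of an equivalence class. The face poset of the coarse subdivision orders coarse cells by $C\le C'$ iff $C$ lies in the closure of $C'$. (When the ground set is finite, $[n]$, this agrees with the geometric definition: for $\omega\in\mathbb{R}^n$ let $\mathcal{F}(\omega)$ be the chain $\emptyset=F_0\subsetneq\cdots\subsetneq F_{k+1}=[n]$ with $\omega$ constant on each $F_i\setminus F_{i-1}$ and strictly increasing from one block to the next; $\mathcal{B}^+(M)=\{\omega\in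 S^{n-2}:\mathcal{F}(\omega)$ is a flag of positive flats$\}$ where $S^{n-2}=\{\omega:\sum\omega_i=0,\sum\omega_i^2=1\}$, and coarse cells are the classes of $\omega$ with equal $M_{\mathcal{F}(\omega)}$.) Graph associahedron: for a graph $\Gamma$ on $n$ nodes, a tube is a proper nonempty set of nodes inducing a connected subgraph. Let $\Delta_\Gamma$ be an $(n-1)$-simplex whose facets are indexed by the nodes; a proper subset of nodes corresponds to the face that is the intersection of the corresponding facets. $P(\Gamma)$ is obtained from $\Delta_\Gamma$ by truncating the faces corresponding to tubes, in increasing order of dimension. (Two tubes are compatible if one contains the other or they are disjoint and their union is not a tube; a tubing is a set of pairwise compatible tubes; by Carr–Devadoss the face poset of $P(\Gamma)$ is isomorphic to the set of tubings ordered by reverse inclusion.)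
   Formalization: The Coxeter diagram Γ is assumed connected (W irreducible): for reducible systems such as A_1×A_1 the claim is false (one coarse cell, but P(Γ) is a segment). The face poset of P(Γ) is taken to be that of its nonempty proper faces, matching flags with k ≥ 1. *)

(* Defs.v *)
From HB Require Import structures.
From mathcomp Require Import all_boot all_order all_algebra.
From mathcomp Require Import all_classical all_reals all_analysis.

Set Implicit Arguments.
Unset Strict Implicit.
Unset Printing Implicit Defensive.

Import Order.TTheory GRing.Theory Num.Theory.
Import numFieldNormedType.Exports.

(** * Coxeter systems *)

(* [coxeter_congr m] is the congruence on words generated by the relations
   (s t)^(m s t) = 1. The relations (s s)^1 = 1 make the generators involutive,
   so that words without inverses suffice. *)
Inductive coxeter_congr (S : Type) (m : S -> S -> nat) :
    seq S -> seq S -> Prop :=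
| coxeter_congr_rel u v s t : 0 < m s t ->
    coxeter_congr m (u ++ flatten (nseq (m s t) [:: s; t]) ++ v) (u ++ v)
| coxeter_congr_refl u : coxeter_congr m u u
| coxeter_congr_sym u v : coxeter_congr m u v -> coxeter_congr m v u
| coxeter_congr_trans u v w :
    coxeter_congr m u v -> coxeter_congr m v w -> coxeter_congr m u w.

Definition word_prod (W : groupType) (S : Type) (gen : S -> W) (u : seq S) : W :=
  (\prod_(s <- u) gen s)%g.

(* [mcox s t = 0] encodes m(s,t) = oo. *)
Record coxeter_system (W : groupType) (S : finType) := CoxeterSystem {
  cgen : S -> W;
  mcox : S -> S -> nat;
  mcox_diag : forall s, mcox s s = 1;
  mcox_sym : forall s t, mcox s t = mcox t s;
  mcox_off : forall s t, s != t -> mcox s t != 1;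
  cgen_generate : forall w : W, exists u : seq S, word_prod cgen u = w;
  cgen_present : forall u v : seq S,
    word_prod cgen u = word_prod cgen v <-> coxeter_congr mcox u v }.

Lemma clength_subproof (W : groupType) (S : finType) (C : coxeter_system W S)
    (w : W) :
  exists n, `[< exists2 u, word_prod (cgen C) u = w & size u = n >].
Proof.
have [u uw] := cgen_generate C w.
by exists (size u); apply/asboolP; exists u.
Qed.

Definition clength (W : groupType) (S : finType) (C : coxeter_system W S)
    (w : W) : nat :=
  ex_minn (clength_subproof C w).

Definition parabolic_subgroup (W : groupType) (S : finType)
    (C : coxeter_system W S) (J : {set S}) (w : W) : Prop :=
  exists2 u : seq S, all (mem J) u & word_prod (cgen C) u = w.

Definition min_coset_rep (W : groupType) (S : finType) (C : coxeter_system W S)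
    (J : {set S}) (w : W) : Prop :=
  forall x, parabolic_subgroup C J x -> clength C w <= clength C (w * x)%g.

Definition diagram (W : groupType) (S : finType) (C : coxeter_system W S) :
    rel S :=
  fun s t => (s != t) && ((mcox C s t == 0) || (3 <= mcox C s t)).

(** * Graph associahedra *)

(* The duality needs an irreducible system. For A_1 x A_1 the matroid is free, so
   all flags give the same M_F and there is a single coarse cell, whereas the
   graph associahedron is a segment and has two proper faces. *)
Definition connected_graph (S : finType) (e : rel S) : bool :=
  [forall s, forall t, connect e s t].

Definition induces_connected (S : finType) (e : rel S) (J : {set S}) : bool :=
  [forall s in J, forall t in J,
     connect [rel x y | [&& x \in J, y \in J & e x y]] s t].

Definition tube (S : finType) (e : rel S) (J : {set S}) : bool :=
  [&& J != finset.set0, J != finset.setT & induces_connected e J].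

(* The combinatorial type of a simple polytope with facets labelled by [L] is
   the family of its nonempty faces, each face being given by the set of
   (labels of) facets that contain it: the polytope itself is [set0], and a face
   [A] is contained in a face [B] iff [B \subset A]. *)
Definition simple_polytope (L : finType) := {set {set L}}.

(* Cutting off the face [G] by a hyperplane, which becomes the facet [l], keeps
   the (truncated) faces [A] that are not contained in [G], and each of those
   that meets [G], i.e. such that [A :|: G] is a face, meets the new facet in a
   new face [l |: A]. *)
Definition truncate (L : finType) (P : simple_polytope L) (G : {set L}) (l : L) :
    simple_polytope L :=
  [set A in P | ~~ (G \subset A)] :|:
  [set l |: A | A in [set A in P | ~~ (G \subset A) && (A :|: G \in P)]].

(* Labels: [inl s] is the facet of the simplex indexed by the node [s] and
   [inr J] the facet created by truncating the face of the tube [J]. *)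
Definition facet_label (S : finType) : finType := (S + {set S})%type.

Definition simplex_face (S : finType) (J : {set S}) : {set facet_label S} :=
  [set inl s | s in J].

Definition node_simplex (S : finType) : simple_polytope (facet_label S) :=
  [set simplex_face J | J : {set S} & J != finset.setT].

(* The face of the simplex indexed by [J] has dimension [#|S| - 1 - #|J|]. *)
Definition graph_associahedron (S : finType) (e : rel S) :
    simple_polytope (facet_label S) :=
  foldl (fun P J => truncate P (simplex_face J) (inr J))
        (node_simplex S)
        (sort (fun I J : {set S} => #|J| <= #|I|) (enum [pred J | tube e J])).

Local Open Scope classical_set_scope.
Local Open Scope ring_scope.

(* The polytope itself would correspond to the flag with k = 0, i.e. to the empty
   simplex, which is not a cell. *)
Definition proper_faces (L : finType) (P : simple_polytope L) : set {set L} :=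
  fun A => A \in P /\ A != finset.set0.

Definition face_le (L : finType) (A B : {set L}) : Prop := B \subset A.

Definition anti_isomorphic (T U : Type) (A : set T) (leA : T -> T -> Prop)
    (B : set U) (leB : U -> U -> Prop) : Prop :=
  exists f : T -> U, set_bij A B f /\
    forall x y, A x -> A y -> (leA x y <-> leB (f y) (f x)).

(** * Matroids, by their independent sets *)

(* Only the data of a matroid: all those used below are minors, or direct sums of
   minors, of the matroid of a vector configuration. *)
Record matroid (T : Type) := Matroid {
  ground : set T;
  indep : set (set T) }.

Definition matroid_restrict (T : Type) (M : matroid T) (F : set T) : matroid T :=
  Matroid (ground M `&` F) [set A | indep M A /\ A `<=` F].

Definition matroid_basis (T : Type) (M : matroid T) (B : set T) : Prop :=
  indep M B /\ forall A, indep M A -> B `<=` A -> A = B.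

Definition matroid_contract (T : Type) (M : matroid T) (F : set T) : matroid T :=
  Matroid (ground M `\` F)
    [set A | A `<=` ground M `\` F /\
       exists2 B, matroid_basis (matroid_restrict M F) B & indep M (A `|` B)].

Definition matroid_empty (T : Type) : matroid T := Matroid set0 [set set0].

Definition matroid_sum (T : Type) (M N : matroid T) : matroid T :=
  Matroid (ground M `|` ground N)
    [set A | exists X Y, [/\ indep M X, indep N Y & A = X `|` Y]].

(* The flag set0 < F_1 < ... < F_k < ground M is given by [:: F_1; ...; F_k]. *)
Definition matroid_of_flag (T : Type) (M : matroid T) (Fs : seq (set T)) :
    matroid T :=
  foldr (@matroid_sum T) (matroid_empty T)
    (pairmap (fun G F => matroid_contract (matroid_restrict M F) G)
             set0 (rcons Fs (ground M))).

Definition vector_matroid (K : fieldType) (V : vectType K) (E : set V) :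
    matroid V :=
  Matroid E [set A | A `<=` E /\
    forall X : seq V, uniq X -> [set` X] `<=` A -> free X].

(** * Root systems *)

Notation root_space R S := {ffun S -> R^o}.

Definition simple_root (R : realType) (S : finType) (s : S) : root_space R S :=
  [ffun t => (t == s)%:R].

Definition cox_form (R : realType) (W : groupType) (S : finType)
    (C : coxeter_system W S) (u v : root_space R S) : R :=
  \sum_(s : S) \sum_(t : S) u s * v t *
    (if mcox C s t == 0%N then -1 else - cos (pi / (mcox C s t)%:R)).

Definition reflection (R : realType) (W : groupType) (S : finType)
    (C : coxeter_system W S) (s : S) (v : root_space R S) : root_space R S :=
  v - (2 * cox_form C v (simple_root R s)) *: simple_root R s.

(* The graph of the geometric representation: w = s_1 ... s_k acts as the
   composite of the reflections s_1, ..., s_k. *)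
Definition geom_rep (R : realType) (W : groupType) (S : finType)
    (C : coxeter_system W S) (w : W) (g : root_space R S -> root_space R S) :
    Prop :=
  exists2 u : seq S, word_prod (cgen C) u = w &
    g = fun v => foldr (reflection C) v u.

Definition roots (R : realType) (W : groupType) (S : finType)
    (C : coxeter_system W S) : set (root_space R S) :=
  [set a | exists w g s, geom_rep C w g /\ a = g (simple_root R s)].

Definition pos_roots (R : realType) (W : groupType) (S : finType)
    (C : coxeter_system W S) : set (root_space R S) :=
  [set a | roots C a /\ forall s, 0 <= a s].

Definition pos_roots_in (R : realType) (W : groupType) (S : finType)
    (C : coxeter_system W S) (J : {set S}) : set (root_space R S) :=
  [set a | pos_roots C a /\ a \in <<[seq simple_root R s | s <- enum J]>>%VS].

Definition root_matroid (R : realType) (W : groupType) (S : finType)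
    (C : coxeter_system W S) : matroid (root_space R S) :=
  vector_matroid (pos_roots C).

(** * The positive Bergman complex *)

(* Sign vectors indexed by the positive roots, extended by 0. *)
Definition covectors (R : realType) (W : groupType) (S : finType)
    (C : coxeter_system W S) : set (root_space R S -> int) :=
  [set X | exists f : {scalar root_space R S},
     X = fun a => if a \in pos_roots C then sgz (f a) else 0].

Definition parabolic_flat (R : realType) (W : groupType) (S : finType)
    (C : coxeter_system W S) (F : set (root_space R S)) : Prop :=
  exists w g J, [/\ min_coset_rep C J w, geom_rep C w g &
    F = g @` pos_roots_in C J].

Definition positive_flat (R : realType) (W : groupType) (S : finType)
    (C : coxeter_system W S) (F : set (root_space R S)) : Prop :=
  parabolic_flat C F /\
  exists X, [/\ covectors C X, forall a, pos_roots C a -> 0 <= X a &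
    F = [set a | pos_roots C a /\ X a = 0]].

(* Flags with k >= 1. *)
Definition positive_flag (R : realType) (W : groupType) (S : finType)
    (C : coxeter_system W S) (Fs : seq (set (root_space R S))) : Prop :=
  [/\ Fs <> [::],
      sorted (fun F G : set (root_space R S) => `[< F `<` G >])
        (set0 :: rcons Fs (pos_roots C)) &
      forall F, F \in Fs -> positive_flat C F].

(* Points of the realization of the order complex of the positive flats, in
   barycentric coordinates. As there are only finitely many positive flats, the
   topology of pointwise convergence is that of the realization. *)
Notation bergman_space R S := {ptws set (root_space R S) -> R}.

Definition open_simplex (R : realType) (S : finType)
    (Fs : seq (set (root_space R S))) : set (bergman_space R S) :=
  [set x | [/\ forall F, F \in Fs -> 0 < x F,
               forall F, F \notin Fs -> x F = 0 &
               \sum_(F <- Fs) x F = 1]].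

Definition coarse_cell (R : realType) (W : groupType) (S : finType)
    (C : coxeter_system W S) (Fs : seq (set (root_space R S))) :
    set (bergman_space R S) :=
  \bigcup_(Gs in [set Gs | positive_flag C Gs /\
      matroid_of_flag (root_matroid R C) Gs =
      matroid_of_flag (root_matroid R C) Fs])
    open_simplex Gs.

Definition coarse_cells (R : realType) (W : groupType) (S : finType)
    (C : coxeter_system W S) : set (set (bergman_space R S)) :=
  [set coarse_cell C Fs | Fs in [set Fs | positive_flag C Fs]].

Definition coarse_le (R : realType) (S : finType)
    (C D : set (bergman_space R S)) : Prop :=
  C `<=` closure D.

(* Main.v *)
(* Positive flats are the sets [Phi_J], so a flag is a chain of subsets of [S],
   or a level function [l] on [S]. The independent sets of [M_F] are the sets of
   positive roots whose initial forms (coordinates of highest level) are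
   independent. Supports of roots are exactly the connected subsets of the
   diagram, so [M_F] knows precisely which coordinates of each connected set have
   highest level, that is the set of tubes whose neighbours all have larger level
   than their members. These sets of tubes are exactly the tubings, i.e. the faces
   of the graph associahedron. A tubing containing the tubes of a flag comes from a
   refinement of that flag, which matches closure of cells with inclusion of
   tubings. *)

Require Import Defs.
From HB Require Import structures.
From mathcomp Require Import all_boot all_order all_algebra.
From mathcomp Require Import all_classical all_reals all_analysis.
From mathcomp Require Import zify ring lra.

Set Implicit Arguments.
Unset Strict Implicit.
Unset Printing Implicit Defensive.

Import Order.TTheory GRing.Theory Num.Theory.
Import numFieldNormedType.Exports.

(** Tubings enter through the covering condition [nested]: no tube, nor [S] itself, is covered by
    members of the family properly inside it. Truncating one more tube adds one more clause of this
    kind, and for the tubes of a level function a node of top level is the uncovered one. So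
    polytope and complex meet without pairwise compatibility. Connectedness of supports is proved
    together with positivity: a combination of roots has the union of the supports as its support
    only if nothing cancels. Both come from one induction on length that splits off a dihedral
    suffix. As the root system may be infinite, independence is tested on finite lists, and
    quotients are computed from an explicit basis, the simple roots. That the matroid determines the
    tubing is seen on pairs: a tube [J] with a neighbour [r] is tested on a root supported on both,
    against the simple root of [r]. A flag is refined towards a larger tubing by a lexicographic
    level: the old level, then the size of the smallest tube around the node. *)

(** * Tubings of a graph and level functions on its nodes *)

Section Tubings.
Import mathcomp.boot.fintype mathcomp.boot.finset.
Variables (S : finType) (e : rel S).
Hypothesis e_sym : symmetric e.

(** Connectivity is used in cut form from here on: a path inside [X] from [t] to a node outside [Z]
    has an edge that leaves [Z]. *)
Lemma induces_connected_exit (X Z : {set S}) t :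
  induces_connected e X -> t \in X -> t \in Z -> ~~ (X \subset Z) ->
  exists p q, [/\ p \in X, p \in Z, q \in X, q \notin Z & e p q].
Proof.
move=> /'forall_in_'forall_in_idP cX tX tZ /subsetPn[x xX xZ].
have /connectP[p pp xl] := cX t tX x xX.
elim: p t tX tZ pp xl => [|y p IH] t tX tZ /=.
  by move=> _ xt; rewrite xt tZ in xZ.
move=> /andP[/and3P[_ yX ety] pp] xl.
by have [yZ|yZ] := boolP (y \in Z); [exact: (IH y)|exists t, y].
Qed.

(** Apply the cut condition to the set of nodes reachable from [s], which no edge inside [X]
    leaves. *)
Lemma exit_induces_connected (X : {set S}) :
  (forall (Z : {set S}) t, t \in X -> t \in Z -> ~~ (X \subset Z) ->
    exists p q, [/\ p \in X, p \in Z, q \in X, q \notin Z & e p q]) ->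
  induces_connected e X.
Proof.
move=> exX; apply/'forall_in_'forall_in_idP => s sX t tX.
set r := (X in connect X).
have [/subsetP/(_ t tX)|] := boolP (X \subset [set x | connect r s x]).
  by rewrite inE.
have sZ : s \in [set x | connect r s x] by rewrite inE connect0.
move=> /(exX _ s sX sZ)[p [q [pX pZ qX]]]; rewrite inE => qZ epq.
case/negP: qZ; rewrite inE in pZ; apply: connect_trans pZ _.
by apply: connect1; rewrite /r /= pX qX.
Qed.

(** The test [(p == q) || e p q] treats overlapping and adjacent sets together; these are the two
    ways in which tubes, neither inside the other, can be incompatible. *)
Lemma induces_connectedU (X Y : {set S}) p q :
  induces_connected e X -> induces_connected e Y ->
  p \in X -> q \in Y -> (p == q) || e p q -> induces_connected e (X :|: Y).
Proof.
move=> cX cY pX qY pq; apply: exit_induces_connected => Z t tXY tZ nZ.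
have sub (A : {set S}) : A \subset X :|: Y -> induces_connected e A ->
    (exists x, x \in A :&: Z) -> ~~ (A \subset Z) ->
  exists p q, [/\ p \in X :|: Y, p \in Z, q \in X :|: Y, q \notin Z & e p q].
  move=> /subsetP AXY cA [x /setIP[xA xZ]] AZ.
  have [p' [q' [? ? ? ? ?]]] := induces_connected_exit cA xA xZ AZ.
  by exists p', q'; split => //; exact: AXY.
have [XZ|nXZ] := boolP (X \subset Z); last first.
  have [xZ|] := boolP (X :&: Z == set0); last first.
    by move=> /set0Pn; move/(sub X (subsetUl _ _) cX)/(_ nXZ).
  have pZ : p \notin Z.
    by apply: contraL pX => pZ; apply/negP => pX; move/eqP/setP/(_ p): xZ;
       rewrite !inE pX pZ.
  have [YZ|nYZ] := boolP (Y \subset Z); last first.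
    apply: (sub Y (subsetUr _ _) cY) => //; exists t; rewrite inE tZ andbT.
    case/setUP: tXY => // tX.
    by move/eqP/setP/(_ t): xZ; rewrite !inE tX tZ.
  have qZ := subsetP YZ _ qY.
  exists q, p; rewrite !inE pX qY pZ qZ orbT; split => //.
  case/orP: pq => [/eqP pq|]; last by rewrite e_sym.
  by rewrite pq qZ in pZ.
have pZ := subsetP XZ _ pX.
have nYZ : ~~ (Y \subset Z) by apply: contra nZ; rewrite subUset XZ.
have [qZ|qZ] := boolP (q \in Z).
  by apply: (sub Y (subsetUr _ _) cY) => //; exists q; rewrite inE qY.
exists p, q; rewrite !inE pX qY orbT; split => //.
by case/orP: pq => // /eqP pq; rewrite -pq pZ in qZ.
Qed.

Lemma induces_connected1 (s : S) : induces_connected e [set s].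
Proof.
apply: exit_induces_connected => Z t; rewrite inE => /eqP -> sZ.
by rewrite sub1set sZ.
Qed.

Definition tubes : {set {set S}} := [set J | tube e J].

(* When [l] is the level function of a chain of subsets of [S], these are the
   connected components of the members of the chain. *)
Definition level_tubes (l : S -> nat) : {set {set S}} :=
  [set J | tube e J && [forall t in J, forall q in J, forall r,
     (r \notin J) ==> e q r ==> (l t < l r)]].

Lemma level_tubesP l J : reflect
  (tube e J /\ forall t q r, t \in J -> q \in J -> r \notin J -> e q r ->
     l t < l r)
  (J \in level_tubes l).
Proof.
rewrite inE; apply: (iffP andP) => -[tJ h]; split => //.
  move=> t q r tJ' qJ rJ eqr.
  by move/forall_inP/(_ t tJ')/forall_inP/(_ q qJ)/forallP/(_ r): h;
     rewrite rJ eqr.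
apply/forall_inP => t tJ'; apply/forall_inP => q qJ; apply/forallP => r.
by apply/implyP => rJ; apply/implyP => eqr; exact: (h t q r).
Qed.

Definition level_component (l : S -> nat) (t : S) : {set S} :=
  [set x | connect [rel x y | [&& l x <= l t, l y <= l t & e x y]] t x].

Lemma level_component_refl l t : t \in level_component l t.
Proof. by rewrite inE connect0. Qed.

Lemma level_component_le l t x : x \in level_component l t -> l x <= l t.
Proof.
rewrite inE => /connectP[p pp ->]; elim/last_ind: p pp => // p y _.
by rewrite rcons_path last_rcons => /andP[_ /and3P[]].
Qed.

Lemma level_component_nbr l t x r : x \in level_component l t ->
  r \notin level_component l t -> e x r -> l t < l r.
Proof.
move=> xt rt exr; rewrite ltnNge; apply: contra rt => rt.
have xl := level_component_le xt; move: xt; rewrite !inE => xt.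
by apply: connect_trans xt _; apply: connect1; rewrite /= xl rt.
Qed.

Lemma level_component_exit l t (Z : {set S}) y : t \in Z ->
  y \in level_component l t -> y \notin Z ->
  exists p q, [/\ p \in level_component l t, p \in Z,
                  q \in level_component l t, q \notin Z & e p q].
Proof.
move=> tZ; rewrite inE => /connectP[p pp ->].
elim/last_ind: p pp => [|p x IH]; first by rewrite tZ.
rewrite rcons_path last_rcons => /andP[pp ex] xZ.
have [lZ|lZ] := boolP (last t p \in Z); last exact: IH.
have lt : last t p \in level_component l t by rewrite inE; apply/connectP; exists p.
exists (last t p), x; case/and3P: (ex) => _ _ elx; split => //.
by move: lt; rewrite !inE => lt; apply: connect_trans lt (connect1 ex).
Qed.

Lemma level_component_connected l t : induces_connected e (level_component l t).
Proof.
apply: exit_induces_connected => Z s st sZ /subsetPn[x xt xZ].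
have [tZ|tZ] := boolP (t \in Z); first exact: level_component_exit xZ.
have [|||p [q [pt pZ qt qZ epq]]] := @level_component_exit l t (~: Z) s.
- by rewrite inE.
- by [].
- by rewrite inE sZ.
rewrite !in_setC negbK in pZ qZ.
by exists q, p; rewrite e_sym in epq; split.
Qed.

Lemma level_component_tube l t : level_component l t != setT ->
  level_component l t \in level_tubes l.
Proof.
move=> ntT; apply/level_tubesP; split.
  rewrite /tube ntT level_component_connected !andbT.
  by apply/set0Pn; exists t; exact: level_component_refl.
move=> x q r xt qt rt eqr; apply: leq_ltn_trans (level_component_le xt) _.
exact: level_component_nbr eqr.
Qed.

Lemma level_component_lt l t r : l t < l r -> r \notin level_component l t.
Proof. by rewrite ltnNge; apply: contra; exact: level_component_le. Qed.

(** This tube contains [t] and misses [r]: it turns an inequality of levels into a statement about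
    tubes. *)
Lemma level_component_tube_lt l t r : l t < l r ->
  level_component l t \in level_tubes l.
Proof.
move=> /level_component_lt rt; apply: level_component_tube.
by apply: contraNneq rt => ->; rewrite inE.
Qed.

(** The top level of a connected set is visible from the tubes alone. An edge of [X] leaving a tube
    around [t] climbs above [l t]; conversely, a node of [X] above [t] is missed by the component of
    [t] in its sublevel set. *)
Lemma max_levelP l (X : {set S}) t : induces_connected e X -> t \in X ->
  (forall s, s \in X -> l s <= l t) <->
  (forall Z, Z \in level_tubes l -> t \in Z -> X \subset Z).
Proof.
move=> cX tX; split => [tmax Z /level_tubesP[_ Zl] tZ|h s sX].
  apply: contraT => nXZ.
  have [p [q [pX pZ qX qZ epq]]] := induces_connected_exit cX tX tZ nXZ.
  by have := Zl t p q tZ pZ qZ epq; rewrite ltnNge tmax.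
rewrite leqNgt; apply/negP => lts.
have /h/(_ (level_component_refl l t))/subsetP/(_ s sX) :=
  level_component_tube_lt lts.
by rewrite (negbTE (level_component_lt lts)).
Qed.

Lemma level_tubes_coarsen l l' : (forall s t, l s < l t -> l' s < l' t) ->
  level_tubes l \subset level_tubes l'.
Proof.
move=> ll'; apply/subsetP => J /level_tubesP[tJ h]; apply/level_tubesP.
by split => // t q r tJ' qJ rJ eqr; exact/ll'/(h t q r).
Qed.

(** A tubing in covering form: two tubes that overlap or touch without inclusion would cover their
    connected union. The case [X = setT] also excludes families that cover all nodes. *)
Definition nested (T : {set {set S}}) : Prop :=
  (forall Y, Y \in T -> tube e Y) /\
  forall X : {set S}, tube e X \/ X = setT ->
    exists2 x, x \in X & forall Y, Y \in T -> Y \proper X -> x \notin Y.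

Hypothesis e_conn : induces_connected e setT.

Lemma tube_or_fullP (X : {set S}) : X != set0 -> induces_connected e X ->
  tube e X \/ X = setT.
Proof.
by move=> X0 cX; have [->|nT] := eqVneq X setT; [right|left; rewrite /tube X0 nT].
Qed.

Lemma tube_or_full_connected (X : {set S}) : tube e X \/ X = setT ->
  induces_connected e X.
Proof. by case=> [/and3P[]|->]. Qed.

(** The uncovered node of [X] is one of top level. The node [x0] makes [setT] nonempty. *)
Lemma level_tubes_nested (x0 : S) l : nested (level_tubes l).
Proof.
split=> [Y /level_tubesP[]//|X XT].
have cX := tube_or_full_connected XT.
have [x xX] : exists x, x \in X.
  by case: XT => [/and3P[/set0Pn[x xX] _ _]|->]; [exists x|exists x0].
case: (arg_maxnP l xX) => t tX tmax; exists t => // Y YT YX; apply/negP => tY.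
have := (max_levelP l cX tX).1 tmax Y YT tY.
by case/andP: YX => _ /negbTE ->.
Qed.

(** If both were proper in their union, which is connected, they would cover it, against
    [nested]. *)
Lemma nested_comparable T (Y Z : {set S}) p q : nested T ->
  Y \in setT |: T -> Z \in setT |: T -> p \in Y -> q \in Z ->
  (p == q) || e p q -> Y \subset Z \/ Z \subset Y.
Proof.
move=> [Ttube Tnest]; rewrite !inE => /orP[/eqP->|YT]; first by right; apply/subsetP.
move=> /orP[/eqP->|ZT] pY qZ pq; first by left; apply/subsetP.
have [/and3P[_ _ cY] /and3P[_ _ cZ]] := (Ttube _ YT, Ttube _ ZT).
have cU := induces_connectedU cY cZ pY qZ pq.
have [|x] := Tnest (Y :|: Z).
  by apply: tube_or_fullP => //; apply/set0Pn; exists p; rewrite inE pY.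
move=> xU xT; case/setUP: xU => x_in.
  have := xT Y YT; rewrite properEneq subsetUl andbT x_in.
  by case: eqP => [-> _|_ /(_ isT)//]; right; exact: subsetUr.
have := xT Z ZT; rewrite properEneq subsetUr andbT x_in.
by case: eqP => [-> _|_ /(_ isT)//]; left; exact: subsetUl.
Qed.

(** Adjoining [setT] makes the minimum exist for nodes in no tube. Read as a level, this size has
    exactly the members of a nested [T] as its tubes. *)
Definition hull_size (T : {set {set S}}) (s : S) : nat :=
  #|[arg min_(Y < setT | (Y \in setT |: T) && (s \in Y)) #|Y|]|.

Lemma hull_sizeP T s : exists Y : {set S}, [/\ Y \in setT |: T, s \in Y,
  hull_size T s = #|Y| &
  forall Z, Z \in setT |: T -> s \in Z -> #|Y| <= #|Z|].
Proof.
rewrite /hull_size; case: arg_minnP => [|Y /andP[YT sY] Ymin].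
  by rewrite !inE eqxx.
by exists Y; split => // Z ZT sZ; apply: Ymin; rewrite ZT.
Qed.

Lemma hull_size_le T s Z : Z \in setT |: T -> s \in Z -> hull_size T s <= #|Z|.
Proof. by have [Y [_ _ -> h]] := hull_sizeP T s; exact: h. Qed.

(** Nodes are ordered by [l], with ties broken by [hull_size T], which grows outwards in the tubing.
    The inclusion of [level_tubes l] in [T] keeps the order by [l] from contradicting [T]. *)
Lemma nested_refine T l : nested T -> level_tubes l \subset T ->
  exists l', (forall s t, l s < l t -> l' s < l' t) /\ level_tubes l' = T.
Proof.
move=> nT /subsetP lT; have [Ttube Tnest] := nT.
have hS s : hull_size T s <= #|S|.
  by rewrite (leq_trans (hull_size_le (Z := setT) _ _)) ?cardsT ?inE ?eqxx.
(* Since [hull_size] is at most [#|S|], the factor [#|S|.+1] makes this sum encode the lexicographic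
   order. *)
exists (fun s => l s * #|S|.+1 + hull_size T s); split => [s t|].
  by have := hS s; nia.
have lex r t : (l t * #|S|.+1 + hull_size T t < l r * #|S|.+1 + hull_size T r) =
    (l t < l r) || ((l t == l r) && (hull_size T t < hull_size T r)).
  have := hS r; have := hS t; case: (ltngtP (l t) (l r)) => [h|h|->] /=; [nia|nia|lia].
apply/setP => Y; apply/level_tubesP/idP => [[tY Yl]|YT].
  (* [t] is a node of [Y] covered by no smaller member of [T], and [Z] is its hull; the aim is
     [Z = Y]. *)
  have [|t tY' tmax] := Tnest Y; first by left.
  have [Z [ZT tZ hZ Zmin]] := hull_sizeP T t.
  have YnT : Y != setT by case/and3P: tY.
  have [ZY|ZY] := eqVneq Z Y.
    by move: ZT; rewrite ZY inE => /orP[]//; rewrite inE (negbTE YnT).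
  have nZY : ~~ (Z \subset Y).
    apply/negP => sZY; have pZY : Z \proper Y by rewrite properEneq ZY.
    move: ZT; rewrite inE => /orP[|ZT].
      by rewrite inE => /eqP ZT; rewrite ZT properE subsetT andbF in pZY.
    by have := tmax _ ZT pZY; rewrite tZ.
  have cZ : induces_connected e Z.
    by move: ZT; rewrite !inE => /orP[/eqP->//|/Ttube/and3P[]].
  have [p [r [pZ pY rZ rY epr]]] := induces_connected_exit cZ tZ tY' nZY.
  (* As [r] lies in [Z], its hull is no larger than that of [t], so it can be higher only through
     [l]. Then the [l]-component of [t] is in [T] and misses [r], while minimality of [Z] forces it
     to equal [Z]. *)
  have := Yl t p r tY' pY rY epr; rewrite lex [hull_size T t < _]ltnNge.
  rewrite hZ (hull_size_le ZT rZ) andbF orbF => ltr.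
  have KT := lT _ (level_component_tube_lt ltr).
  have KT' : level_component l t \in setT |: T by rewrite inE KT orbT.
  have tK := level_component_refl l t.
  have rK := level_component_lt ltr.
  have [|/subsetP/(_ r rZ)|KZ] := nested_comparable nT ZT KT' tZ tK _.
  - by rewrite eqxx.
  - by rewrite (negbTE rK).
  have /eqP KE : level_component l t == Z by rewrite eqEcard KZ Zmin.
  by rewrite KE rZ in rK.
split=> [|t q r tY qY rY eqr]; first exact: Ttube.
have YT' : Y \in setT |: T by rewrite inE YT orbT.
rewrite lex.
have [Z [ZT rZ hZ Zmin]] := hull_sizeP T r.
have ltr : hull_size T t < hull_size T r.
  rewrite hZ; apply: leq_ltn_trans (hull_size_le YT' tY) _; apply: proper_card.
  have [|YZ|/subsetP/(_ r rZ)] := nested_comparable nT YT' ZT qY rZ _.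
  - by rewrite eqr orbT.
  - by apply/properP; split => //; exists r.
  - by rewrite (negbTE rY).
(* If [l r < l t], the [l]-component of [r] is in [T] and touches [Y] along the edge from [q] to
   [r], but neither contains the other: one misses [t], the other [r]. *)
rewrite ltr andbT orbC -leq_eqVlt leqNgt; apply/negP => lrt.
have KT : level_component l r \in setT |: T.
  by rewrite inE (lT _ (level_component_tube_lt lrt)) orbT.
have rK := level_component_refl l r.
have [|/subsetP/(_ t tY)|/subsetP/(_ r rK)] := nested_comparable nT YT' KT qY rK _.
- by rewrite eqr orbT.
- by rewrite (negbTE (level_component_lt lrt)).
- by rewrite (negbTE rY).
Qed.

Lemma level_tubes_const n : level_tubes (fun=> n) = set0.
Proof.
apply/setP => Y; rewrite in_set0; apply/negP => /level_tubesP[/and3P[]].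
move=> /set0Pn[t tY] YT _ Yl.
have nTY : ~~ (setT \subset Y).
  by apply: contra YT => sY; rewrite eqEsubset subsetT sY.
have [p [q [_ pY _ qY epq]]] := induces_connected_exit e_conn (in_setT t) tY nTY.
by have := Yl p p q pY pY qY epq; rewrite ltnn.
Qed.

Lemma nested_level_tubes T : nested T -> exists l, level_tubes l = T.
Proof.
move=> nT; have [|l [_ <-]] := @nested_refine T (fun=> 0) nT; last by exists l.
by rewrite level_tubes_const sub0set.
Qed.

End Tubings.

(** * Faces of the iterated truncation *)

Section Truncation.
Import mathcomp.boot.fintype mathcomp.boot.finset.
Variables (S : finType) (e : rel S).
Hypothesis e_sym : symmetric e.
Hypothesis e_conn : induces_connected e setT.

Local Notation L := (facet_label S).

(* The faces of the polytope obtained after truncating the tubes in [Q]: no [X]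
   in [Q], nor [S] itself, is covered by nodes and smaller tubes of the face. *)
Definition truncated_face (Q : seq {set S}) (A : {set L}) : Prop :=
  (forall Y, inr Y \in A -> Y \in Q) /\
  forall X, X \in setT :: Q -> exists2 x, x \in X &
    inl x \notin A /\ forall Y, inr Y \in A -> Y \proper X -> x \notin Y.

Lemma node_simplexP (A : {set L}) : A \in node_simplex S <-> truncated_face [::] A.
Proof.
split=> [/imsetP[J JT ->]|[A0 AT]].
  split=> [Y /imsetP[x _ //]|X]; rewrite inE => /eqP->.
  have /subsetPn[x _ xJ] : ~~ (setT \subset J) by rewrite inE in JT; rewrite subTset.
  exists x; rewrite ?inE //; split; last by move=> Y /imsetP[].
  by apply: contra xJ => /imsetP[y yJ [->]].
apply/imsetP; exists [set s | inl s \in A].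
  rewrite inE; apply/eqP => /setP AE; have [|x _ [+ _]] := AT setT.
    by rewrite inE.
  by have := AE x; rewrite !inE => ->.
apply/setP => -[s|Y]; last first.
  by apply/idP/imsetP => [/A0//|[]].
apply/idP/imsetP => [sA|[t]]; first by exists s; rewrite ?inE.
by rewrite inE => tA [->].
Qed.

(** As larger tubes are cut first, no label of a face lies properly inside [J], so the clause for
    [J] only asks for a node of [J] outside the face. The condition that [A :|: simplex_face J] be a
    face matches the effect of the label [inr J] on the sets that meet [J]. *)
Lemma truncateP (Q : seq {set S}) (P : simple_polytope L) (J : {set S}) :
  (forall A, A \in P <-> truncated_face Q A) ->
  J \notin Q -> tube e J ->
  (forall X, X \in Q -> tube e X /\ #|J| <= #|X|) ->
  (forall X, tube e X -> #|J| < #|X| -> X \in Q) ->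
  forall A, A \in truncate P (simplex_face J) (inr J) <->
    truncated_face (J :: Q) A.
Proof.
move=> PQ JQ tJ Qbig bigQ.
have GA (A : {set L}) : (simplex_face J \subset A) = (J \subset [set s | inl s \in A]).
  apply/subsetP/subsetP => [h s sJ|h x /imsetP[s sJ ->]].
    by rewrite inE; apply: h; apply/imsetP; exists s.
  by have := h s sJ; rewrite inE.
have noY (Y : {set S}) : Y \in J :: Q -> ~~ (Y \proper J).
  rewrite inE => /orP[/eqP->|/Qbig[_ JY]]; first by rewrite properxx.
  by apply/negP => /proper_card; rewrite ltnNge JY.
have JT : J != setT by case/and3P: tJ.
have cJ : induces_connected e J by case/and3P: tJ.
(* The union is connected and larger than [J], hence is all of [S] or a tube that was cut
   earlier. *)
have mem_big (X : {set S}) p : X \in setT :: Q -> p \in X -> p \in J -> 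
    X :|: J \in setT :: Q.
  move=> XQ pX pJ; have [XJ|XJ] := eqVneq (X :|: J) setT.
    by rewrite XJ mem_head.
  have cX : induces_connected e X.
    by move: XQ; rewrite inE => /orP[/eqP->//|/Qbig[/and3P[]]].
  have [JX|JX] := boolP (J \subset X); first by rewrite (setUidPl JX).
  rewrite inE; apply/orP; right; apply: bigQ.
    rewrite /tube XJ (induces_connectedU e_sym cX cJ pX pJ) ?eqxx // !andbT.
    by apply/set0Pn; exists p; rewrite inE pX.
  apply: proper_card; rewrite properE subsetUr subUset subxx andbT /=.
  apply/negP => XJ'; move: XQ; rewrite inE => /orP[/eqP XT|/Qbig[_ JX']].
    by rewrite XT subsetT in JX.
  have : X \proper J.
    by rewrite properE XJ'.
  by move=> /proper_card; rewrite ltnNge JX'.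
move=> A; split.
  move=> /setUP[|/imsetP[A0]].
    rewrite inE GA => /andP[AP /subsetPn[x xJ]]; rewrite inE => xA.
    have [AQ Acov] := (PQ A).1 AP.
    split=> [Y /AQ YQ|X]; first by rewrite inE YQ orbT.
    rewrite !inE orbCA => /orP[/eqP->|XQ]; last by apply: Acov; rewrite inE.
    exists x => //; split => // Y /AQ YQ.
    by rewrite (negbTE (noY Y _)) // inE YQ orbT.
  rewrite inE GA => /and3P[A0P /subsetPn[x xJ]]; rewrite inE => xA A0J ->.
  have [AQ Acov] := (PQ A0).1 A0P; have [_ AJcov] := (PQ _).1 A0J.
  have AY Y : inr Y \in inr J |: A0 -> Y \in J :: Q.
    by rewrite in_setU1 => /orP[/eqP[->]|/AQ YQ]; rewrite inE ?eqxx ?YQ ?orbT.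
  split=> // X; rewrite !inE orbCA => /orP[/eqP->|XQ].
    exists x => //; split; first by rewrite in_setU1.
    by move=> Y /AY/noY/negbTE ->.
  have [y yX [yA yY]] : exists2 x, x \in X &
      inl x \notin A0 :|: simplex_face J /\
      forall Y, inr Y \in A0 :|: simplex_face J -> Y \proper X -> x \notin Y.
    by apply: AJcov; rewrite inE.
  exists y => //; move: yA; rewrite in_setU1 inE => /norP[yA yJ]; split => // Y.
  rewrite in_setU1 => /orP[/eqP[->] _|YA]; last by apply: yY; rewrite inE YA.
  by apply: contra yJ => yJ; apply/imsetP; exists y.
move=> [AQ Acov]; apply/setUP.
have [x xJ [xA xY]] : exists2 x, x \in J & inl x \notin A /\
    forall Y, inr Y \in A -> Y \proper J -> x \notin Y.
  by apply: Acov; rewrite !inE eqxx orbT.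
have [JA|JA] := boolP (inr J \in A); last first.
  left; rewrite inE GA; apply/andP; split; last first.
    by apply/subsetPn; exists x => //; rewrite inE.
  apply/PQ; split => [Y YA|X XQ]; last first.
    by apply: Acov; move: XQ; rewrite !inE => /orP[]->; rewrite ?orbT.
  by have := AQ Y YA; rewrite inE => /orP[/eqP YJ|//]; rewrite -YJ YA in JA.
right; apply/imsetP; exists (A :\ inr J); last by rewrite setD1K.
(* For [X] meeting [J], the uncovered node is taken from [X :|: J]: it avoids [J] because [inr J] is
   in [A], so it lies in [X]. *)
have AJP : (A :\ inr J) :|: simplex_face J \in P.
  apply/PQ; split => [Y|X XQ].
    rewrite !inE => /orP[/andP[YJ /AQ]|/imsetP[]//].
    by rewrite inE => /orP[/eqP YJ'|//]; rewrite YJ' eqxx in YJ.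
  have XQ' : X \in [:: setT, J & Q].
    by move: XQ; rewrite !inE => /orP[]->; rewrite ?orbT.
  have [dXJ|] := boolP (X :&: J == set0).
    have XJ y : y \in X -> y \notin J.
      by move=> yX; apply/negP => yJ; move/eqP/setP/(_ y): dXJ; rewrite !inE yX yJ.
    have [y yX [yA yY]] := Acov X XQ'; exists y => //; split.
      rewrite !inE negb_or (negbTE yA) andbF /=.
      by apply/imsetP => -[z zJ [yz]]; rewrite -yz (negbTE (XJ y yX)) in zJ.
    move=> Y; rewrite !inE => /orP[/andP[_ YA]|/imsetP[]//]; exact: yY.
  move=> /set0Pn[p /setIP[pX pJ]].
  have XJQ := mem_big X p XQ pX pJ.
  have XJQ' : X :|: J \in [:: setT, J & Q].
    by move: XJQ; rewrite !inE => /orP[]->; rewrite ?orbT.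
  have [y yXJ [yA yY]] := Acov _ XJQ'.
  have yJ : y \notin J.
    apply: yY => //; rewrite properE subsetUr /= subUset subxx andbT.
    apply/negP => XJ; move: XQ; rewrite inE => /orP[/eqP XT|XQ].
      by rewrite XT subTset (negbTE JT) in XJ.
    have [_ JX] := Qbig _ XQ.
    have /eqP XE : X == J by rewrite eqEcard XJ.
    by rewrite XE (negbTE JQ) in XQ.
  have yX : y \in X by case/setUP: yXJ => // yJ'; rewrite yJ' in yJ.
  exists y => //; split.
    rewrite !inE negb_or (negbTE yA) andbF /=.
    by apply/imsetP => -[z zJ [yz]]; rewrite yz zJ in yJ.
  move=> Y; rewrite !inE => /orP[/andP[_ YA]|/imsetP[]//] YX.
  by apply: yY => //; exact: proper_sub_trans YX (subsetUl _ _).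
rewrite inE GA AJP andbT; apply/andP; split; last first.
  by apply/subsetPn; exists x => //; rewrite !inE.
have [AJQ AJcov] := (PQ _).1 AJP.
apply/PQ; split => [Y YA|X /AJcov[y yX [yA yY]]].
  by apply: AJQ; rewrite inE YA.
exists y => //; split; first by move: yA; rewrite inE => /norP[].
by move=> Y YA; apply: yY; rewrite inE YA.
Qed.

(** Induction on the tubes [Q'] still to be cut. [Q] holds those already cut, latest first, whence
    [rev Q]; the sorting supplies the size comparisons of [truncateP]. *)
Lemma truncate_allP (Q Q' : seq {set S}) (P : simple_polytope L) :
  (forall A, A \in P <-> truncated_face Q A) ->
  uniq (Q' ++ Q) -> (forall X, (X \in Q' ++ Q) = tube e X) ->
  sorted (fun I J : {set S} => #|J| <= #|I|) (rev Q ++ Q') ->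
  forall A, A \in foldl (fun P J => truncate P (simplex_face J) (inr J)) P Q' <->
    truncated_face (enum (tubes e)) A.
Proof.
elim: Q' Q P => [|J Q' IH] Q P PQ unQ memQ sQ A /=.
  rewrite PQ; have eQ : Q =i enum (tubes e).
    by move=> X; rewrite mem_enum inE -memQ.
  by split=> -[AQ Acov]; split => [Y /AQ|X]; rewrite ?eQ // -?eQ // => XQ;
     apply: Acov; move: XQ; rewrite !inE eQ.
have trg : transitive (fun I J : {set S} => #|J| <= #|I|).
  by move=> x y z xy yz; exact: leq_trans yz xy.
have [un1 un2] : J \notin Q /\ uniq (Q' ++ J :: Q).
  rewrite -[J :: Q]cat1s uniq_catCA; split=> //.
  by move: unQ => /= /andP[]; rewrite mem_cat => /norP[].
apply: (IH (J :: Q)) => //.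
- apply: truncateP => //.
  + by rewrite -memQ mem_cat mem_head.
  + move=> X XQ; rewrite -memQ mem_cat XQ orbT; split => //.
    move: sQ; rewrite sorted_pairwise // pairwise_cat => /and3P[/allrelP h _ _].
    by apply: h; rewrite ?mem_rev ?mem_head.
  + move=> X tX JX; move: (tX); rewrite -memQ mem_cat inE -orbA.
    case/or3P => // [/eqP XJ|XQ']; first by rewrite XJ ltnn in JX.
    move: sQ; rewrite sorted_pairwise // pairwise_cat => /and3P[_ _] /=.
    by move=> /andP[/allP/(_ X XQ')]; rewrite leqNgt JX.
- by move=> X; rewrite -memQ !mem_cat !inE; case: (X == J); rewrite ?orbT.
- by rewrite rev_cons cat_rcons.
Qed.

Lemma graph_associahedronP (A : {set L}) :
  A \in graph_associahedron e <->
  exists2 T, nested e T & A = [set inr Y | Y in T].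
Proof.
set Q := sort (fun I J : {set S} => #|J| <= #|I|) (enum [pred J | tube e J]).
rewrite /graph_associahedron -/Q.
rewrite (truncate_allP (Q := [::]) (Q' := Q)) //; last 4 first.
- exact: node_simplexP.
- by rewrite cats0 sort_uniq enum_uniq.
- by move=> X; rewrite cats0 mem_sort mem_enum.
- by apply: sort_sorted => I J; exact: leq_total.
split=> [[AQ Acov]|[T [Ttube Tnest] ->]].
  exists [set Y | inr Y \in A].
    split=> [Y|X XT].
      by rewrite inE => /AQ; rewrite mem_enum inE.
    have [|x xX [xA xY]] := Acov X.
      by rewrite inE mem_enum inE; case: XT => [->|->]; rewrite ?eqxx ?orbT.
    by exists x => // Y; rewrite inE => YA; exact: xY.
  apply/setP => -[s|Y]; last first.
    apply/idP/imsetP => [YA|[Z]]; first by exists Y; rewrite ?inE.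
    by rewrite inE => ZA [->].
  apply/idP/imsetP => [sA|[]//]; exfalso.
  (* No label of an original facet survives: in the clause for [[set s]] the only candidate is [s].
     If [s] is the only node, the clause for [setT] takes this part. *)
  have [ST|ST] := eqVneq [set s] setT.
    have [|x _ [xA _]] := Acov setT; first by rewrite mem_head.
    have : x \in [set s] by rewrite ST inE.
    by rewrite inE => /eqP xs; rewrite xs sA in xA.
  have [|x] := Acov [set s]; last by rewrite inE => /eqP-> []; rewrite sA.
  rewrite inE mem_enum inE /tube ST induces_connected1 !andbT; apply/orP; right.
  by apply/set0Pn; exists s; rewrite inE.
split=> [Y /imsetP[Z ZT [->]]|X XQ]; first by rewrite mem_enum inE Ttube.
have [|x xX xY] := Tnest X.
  by move: XQ; rewrite inE mem_enum inE => /orP[/eqP->|]; [right|left].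
exists x => //; split; first by apply/imsetP => -[].
by move=> Y /imsetP[Z ZT [->]]; exact: xY.
Qed.

End Truncation.

(** * The geometric representation and word length *)

Section Roots.
Import mathcomp.boot.fintype mathcomp.boot.finset.
Variables (R : realType) (W : groupType) (S : finType) (C : coxeter_system W S).
Local Open Scope ring_scope.

Local Notation V := (root_space R S).
Local Notation B := (@cox_form R W S C).
Local Notation alpha := (simple_root R).
Local Notation refl := (@reflection R W S C).

Definition gram (s t : S) : R :=
  if mcox C s t == 0%N then -1 else - cos (pi / (mcox C s t)%:R).

Lemma gram_sym s t : gram s t = gram t s.
Proof. by rewrite /gram mcox_sym. Qed.

Lemma gram_diag s : gram s s = 1.
Proof. by rewrite /gram mcox_diag /= divr1 cospi opprK. Qed.

Lemma scale_ffunE (a : R) (v : V) t : (a *: v) t = a * v t.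
Proof. by rewrite ffunE. Qed.

Lemma lin_ffunE (a : R) (v w : V) t : (a *: v + w) t = a * v t + w t.
Proof. by rewrite ffunE scale_ffunE. Qed.

Lemma simple_rootE (s t : S) : alpha s t = (t == s)%:R.
Proof. by rewrite ffunE. Qed.

Lemma cox_form_sym u v : B u v = B v u.
Proof.
rewrite /cox_form exchange_big; apply: eq_bigr => s _; apply: eq_bigr => t _.
by rewrite -!/(gram _ _) gram_sym [u t * _]mulrC.
Qed.

Lemma cox_form_linl v a x y : B (a *: x + y) v = a * B x v + B y v.
Proof.
rewrite /cox_form mulr_sumr -big_split; apply: eq_bigr => s _ /=.
rewrite mulr_sumr -big_split; apply: eq_bigr => t _ /=.
by rewrite lin_ffunE !mulrDl !mulrA.
Qed.

Lemma cox_formZl v a x : B (a *: x) v = a * B x v.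
Proof.
rewrite /cox_form mulr_sumr; apply: eq_bigr => s _.
by rewrite mulr_sumr; apply: eq_bigr => t _; rewrite scale_ffunE !mulrA.
Qed.

Lemma cox_form_linr v a x y : B v (a *: x + y) = a * B v x + B v y.
Proof. by rewrite cox_form_sym cox_form_linl ![B _ v]cox_form_sym. Qed.

Lemma cox_form_simplel s v : B (alpha s) v = \sum_t v t * gram s t.
Proof.
rewrite /cox_form (bigD1 s) //= [X in _ + X]big1 ?addr0 => [|t ts].
  by apply: eq_bigr => t _; rewrite ffunE eqxx mul1r.
by apply: big1 => x _; rewrite ffunE (negbTE ts) !mul0r.
Qed.

Lemma cox_form_simple s t : B (alpha s) (alpha t) = gram s t.
Proof.
rewrite cox_form_simplel (bigD1 t) //= big1 ?addr0 ?ffunE ?eqxx ?mul1r // => x xt.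
by rewrite ffunE (negbTE xt) mul0r.
Qed.

Lemma reflectionE s v : refl s v = (- (2 * B v (alpha s))) *: alpha s + v.
Proof. by rewrite /reflection scaleNr addrC. Qed.

Lemma reflection_coord s v t :
  refl s v t = v t - 2 * B v (alpha s) * (t == s)%:R.
Proof. by rewrite reflectionE lin_ffunE simple_rootE mulNr addrC. Qed.

Lemma reflection_lin s a x y : refl s (a *: x + y) = a *: refl s x + refl s y.
Proof.
apply/ffunP => t; rewrite lin_ffunE !reflection_coord lin_ffunE cox_form_linl.
ring.
Qed.

Lemma reflection_form s x y : B (refl s x) (refl s y) = B x y.
Proof.
rewrite !reflectionE !(cox_form_linl, cox_form_linr) cox_form_simple gram_diag.
rewrite [B (alpha s) _]cox_form_sym; ring.
Qed.

Lemma reflection_simple s : refl s (alpha s) = - alpha s.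
Proof.
apply/ffunP => t; rewrite reflection_coord cox_form_simple gram_diag.
rewrite simple_rootE [RHS]ffunE simple_rootE; ring.
Qed.

Lemma reflectionK s : involutive (refl s).
Proof.
move=> v; apply/ffunP => t; rewrite !reflection_coord reflectionE.
rewrite cox_form_linl cox_form_simple gram_diag; ring.
Qed.

Definition word_act (u : seq S) (v : V) : V := foldr refl v u.

Lemma word_act_cat u1 u2 v : word_act (u1 ++ u2) v = word_act u1 (word_act u2 v).
Proof. by rewrite /word_act foldr_cat. Qed.

Lemma word_act_lin u a x y :
  word_act u (a *: x + y) = a *: word_act u x + word_act u y.
Proof. by elim: u => //= s u IH; rewrite -!/(word_act _ _) IH reflection_lin. Qed.

Lemma word_act_form u x y : B (word_act u x) (word_act u y) = B x y.
Proof. by elim: u => //= s u IH; rewrite reflection_form. Qed.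

Lemma word_actZ u a x : word_act u (a *: x) = a *: word_act u x.
Proof.
have act0 : word_act u 0 = 0.
  by have := word_act_lin u (-1) 0 0; rewrite scaler0 addr0 scaleN1r addNr.
by have := word_act_lin u a x 0; rewrite !addr0 act0 addr0.
Qed.

Lemma word_actN u x : word_act u (- x) = - word_act u x.
Proof. by rewrite -scaleN1r word_actZ scaleN1r. Qed.

Lemma reflection_fix s v : B v (alpha s) = 0 -> refl s v = v.
Proof. by move=> vs; rewrite reflectionE vs mulr0 oppr0 scale0r add0r. Qed.

(* On the plane of [alpha s] and [alpha t], [s t] is the rotation by twice the
   angle [pi / m], and it fixes the orthogonal complement. *)
Lemma dihedral_act s t (k : nat) x : s != t -> (0 < mcox C s t)%N ->
  let th := pi / (mcox C s t)%:R in
  word_act (flatten (nseq k [:: s; t]))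
    (sin (x + th) *: alpha s + sin x *: alpha t) =
  sin (x + (2 * k)%:R * th + th) *: alpha s + sin (x + (2 * k)%:R * th) *: alpha t.
Proof.
move=> st m0 th; have ts : (t == s) = false by rewrite eq_sym (negbTE st).
elim: k x => [|k IH] x; first by rewrite muln0 mul0r addr0.
rewrite /= -/(word_act _ _) IH.
set y := x + (2 * k)%:R * th.
have -> : x + (2 * k.+1)%:R * th = y + th + th.
  by rewrite /y mulnSr natrD; ring.
have gst : gram s t = - cos th by rewrite /gram; case: (mcox C s t) m0 @th {IH y}.
have sin3 z : sin (z + th + th) = 2 * cos th * sin (z + th) - sin z.
  have zE : sin z = sin (z + th - th) by rewrite addrK.
  by rewrite [in RHS]zE sinD sinB; ring.
apply/ffunP => r; rewrite !reflection_coord reflectionE !cox_form_linl.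
rewrite !cox_formZl !cox_form_simple !gram_diag (gram_sym t s) gst.
rewrite !lin_ffunE !scale_ffunE !simple_rootE (sin3 (y + th)) (sin3 y); ring.
Qed.

(** For [s != t] the plane of the two simple roots has Gram determinant [sin th ^+ 2], which is
    nonzero. So [v] splits into a part in the plane, where the word is a rotation by [2 pi], and an
    orthogonal part fixed by both reflections. *)
Lemma coxeter_relation_act s t v : (0 < mcox C s t)%N ->
  word_act (flatten (nseq (mcox C s t) [:: s; t])) v = v.
Proof.
move=> m0; have [->|st] := eqVneq s t; first by rewrite mcox_diag /= !reflectionK.
set m := mcox C s t in m0 *; pose th : R := pi / m%:R.
have m2 : (1 < m)%N by have := mcox_off C st; rewrite -/m; case: m m0 {th} => [|[]].
have mR : 0 < m%:R :> R by rewrite ltr0n.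
have th0 : 0 < th by rewrite divr_gt0 // pi_gt0.
have thpi : th < pi by rewrite ltr_pdivrMr // ltr_pMr ?pi_gt0 // ltr1n.
have s0 : 0 < sin th by rewrite sin_gt0_pi // thpi th0.
have mth : (2 * m)%:R * th = pi *+ 2.
  by rewrite natrM /th -mulrA [_%:R * (_ / _)]mulrC divfK ?gt_eqF // mulr_natl.
have fixb x : word_act (flatten (nseq m [:: s; t]))
    (sin (x + th) *: alpha s + sin x *: alpha t) =
    sin (x + th) *: alpha s + sin x *: alpha t.
  rewrite dihedral_act // -/m -/th mth addrAC.
  by rewrite -![_ + pi *+ 2]/(_ + pi *+ 2) !sinD2pi.
have fix_s : word_act (flatten (nseq m [:: s; t])) (alpha s) = alpha s.
  (* The phases [0] and [- th] each leave a single simple root, with a nonzero coefficient. *)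
  have := fixb 0; rewrite add0r sin0 scale0r addr0 word_actZ.
  by move/scalerI; apply; rewrite gt_eqF.
have fix_t : word_act (flatten (nseq m [:: s; t])) (alpha t) = alpha t.
  have := fixb (- th); rewrite addNr sin0 scale0r add0r word_actZ.
  by move/scalerI; apply; rewrite sinN oppr_eq0 gt_eqF.
have fix_z k z : B z (alpha s) = 0 -> B z (alpha t) = 0 ->
    word_act (flatten (nseq k [:: s; t])) z = z.
  by move=> zs zt; elim: k => //= k; rewrite -/(word_act _ _) => ->;
     rewrite (reflection_fix zt) (reflection_fix zs).
have gst : gram s t = - cos th.
  by rewrite /gram -/m; case: eqP m0 => // ->.
pose x := B v (alpha s); pose y := B v (alpha t).
pose d := sin th ^+ 2.
have d0 : d != 0 by rewrite expf_neq0 // gt_eqF.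
have dE : d = 1 - cos th ^+ 2 by rewrite /d sin2cos2.
(* Solution of the two linear equations that make [z] orthogonal to both roots. *)
pose p := (x + cos th * y) / d; pose q := (cos th * x + y) / d.
pose z := (- p) *: alpha s + ((- q) *: alpha t + v).
have vE : v = p *: alpha s + (q *: alpha t + z).
  by apply/ffunP => r; rewrite !lin_ffunE; ring.
have pd : p * d = x + cos th * y by rewrite divfK.
have qd : q * d = cos th * x + y by rewrite divfK.
have zs : B z (alpha s) = 0.
  rewrite !cox_form_linl !cox_form_simple gram_diag (gram_sym t s) gst -/x.
  apply: (mulIf d0); rewrite mul0r.
  have -> : (- p * 1 + (- q * - cos th + x)) * d =
    - (p * d) + cos th * (q * d) + x * d by ring.
  by rewrite pd qd dE; ring.
have zt : B z (alpha t) = 0.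
  rewrite !cox_form_linl !cox_form_simple gram_diag gst -/y.
  apply: (mulIf d0); rewrite mul0r.
  have -> : (- p * - cos th + (- q * 1 + y)) * d =
    cos th * (p * d) - q * d + y * d by ring.
  by rewrite pd qd dE; ring.
by rewrite [in LHS]vE 2!word_act_lin fix_s fix_t (fix_z m z zs zt) -vE.
Qed.

(** The relators act trivially, so by the presentation the action is well defined on [W]. *)
Lemma word_act_congr u v x : word_prod (cgen C) u = word_prod (cgen C) v ->
  word_act u x = word_act v x.
Proof.
move=> /cgen_present uv; elim: uv x =>
  {u v} [u v s t m0|//|u v _ IH|u v w _ IH1 _ IH2] x.
- by rewrite !word_act_cat coxeter_relation_act.
- by rewrite IH.
- by rewrite IH1.
Qed.

Local Notation wp := (word_prod (cgen C)).
Local Notation len := (clength C).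

Lemma word_prod_cat u v : wp (u ++ v) = (wp u * wp v)%g.
Proof. by rewrite /word_prod big_cat. Qed.

Lemma word_prod_cons s u : wp (s :: u) = (cgen C s * wp u)%g.
Proof. by rewrite /word_prod big_cons. Qed.

Lemma word_prod1 s : wp [:: s] = cgen C s.
Proof. by rewrite /word_prod big_seq1. Qed.

Lemma word_prod_relation s t : (0 < mcox C s t)%N ->
  wp (flatten (nseq (mcox C s t) [:: s; t])) = 1%g.
Proof.
move=> m0; have -> : 1%g = wp [::] by rewrite /word_prod big_nil.
apply/cgen_present; have := coxeter_congr_rel [::] [::] m0.
by rewrite /= cats0.
Qed.

Lemma cgenV s : (cgen C s * cgen C s)%g = 1%g.
Proof.
have := @word_prod_relation s s; rewrite mcox_diag => /(_ isT) /=.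
by rewrite !word_prod_cons /word_prod big_nil mulg1.
Qed.

Lemma word_prod_rev u : (wp u * wp (rev u))%g = 1%g.
Proof.
elim: u => [|s u IH]; first by rewrite /word_prod big_nil mulg1.
rewrite rev_cons -cats1 word_prod_cons word_prod_cat word_prod1 mulgA -(mulgA _ (wp u)).
by rewrite IH mulg1 cgenV.
Qed.

Lemma clength_word w : exists2 u, wp u = w & size u = len w.
Proof. by rewrite /clength; case: ex_minnP => n /asboolP. Qed.

Lemma clength_le u : (len (wp u) <= size u)%N.
Proof.
by rewrite /clength; case: ex_minnP => n _; apply; apply/asboolP; exists u.
Qed.

(** Relators have even length. Hence right multiplication by a generator always changes the length:
    it is an ascent or a descent. *)
Lemma word_parity u v : wp u = wp v -> odd (size u) = odd (size v).
Proof.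
move=> /cgen_present; elim=> {u v} [u v s t m0|//|u v _ ->//|u v w _ -> _ ->//].
rewrite !size_cat !oddD; congr (_ (+) _); rewrite -[RHS]addFb; congr (_ (+) _).
by elim: (mcox C s t) => //= n ->.
Qed.

Lemma clength_parity u : odd (len (wp u)) = odd (size u).
Proof. by have [v vw <-] := clength_word (wp u); exact: word_parity. Qed.

Lemma clength_mulgen w s : len (w * cgen C s)%g != len w.
Proof.
have [u <- _] := clength_word w; rewrite -word_prod1 -word_prod_cat.
apply/eqP => E; have := clength_parity (u ++ [:: s]).
by rewrite E clength_parity size_cat addn1 /=; case: odd.
Qed.

Lemma mulgenK w s : (w * cgen C s * cgen C s)%g = w.
Proof. by rewrite -mulgA cgenV mulg1. Qed.

(* Alternates between [s] and [t], ending (not starting) with [s]. *)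
Fixpoint alt (s t : S) (n : nat) : seq S :=
  if n is n'.+1 then rcons (alt t s n') s else [::].

Lemma size_alt s t n : size (alt s t n) = n.
Proof. by elim: n s t => //= n IH s t; rewrite size_rcons IH. Qed.

Lemma alt_consS s t n :
  alt s t n.+1 = (if odd n then t else s) :: alt s t n.
Proof.
elim: n s t => // n IH s t.
by rewrite -[alt s t n.+2]/(rcons (alt t s n.+1) s) IH /=; case: odd.
Qed.

Lemma alt_flatten s t n : flatten (nseq n [:: t; s]) = alt s t (n.*2).
Proof.
by elim: n => // n IH; rewrite doubleS !alt_consS /= odd_double -IH.
Qed.

Lemma alt_cat s t a b : exists2 u, alt s t (a + b) = u ++ alt s t b & size u = a.
Proof.
elim: a => [|a [u uE ua]]; first by exists [::].
by exists ((if odd (a + b) then t else s) :: u);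
   rewrite ?addSn ?alt_consS ?uE /= ?ua.
Qed.

(* An alternating word of length [m + 1] is inverse to one of length [m - 1]. *)
Lemma alt_shorten s t k : (0 < mcox C t s <= k)%N ->
  (len (wp (alt s t k.+1)) < k)%N.
Proof.
set m := mcox C t s => /andP[m0 mk].
have [u] := alt_cat s t (k - m) m.+1; rewrite addnS subnK // => -> uk.
have [v vE vm] := alt_cat s t m.-1 m.+1.
have mE : (m.-1 + m.+1 = m.*2)%N by lia.
have := word_prod_relation m0; rewrite -/m alt_flatten -mE vE word_prod_cat => v1.
have vr := word_prod_rev v.
have -> : wp (u ++ alt s t m.+1) = wp (u ++ rev v).
  by rewrite !word_prod_cat; congr (_ * _)%g; apply: (mulgI (wp v)); rewrite v1 vr.
by rewrite (leq_ltn_trans (clength_le _)) // size_cat size_rev uk vm; lia.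
Qed.

End Roots.

(** * Supports of roots are the connected sets of nodes *)

Section RootSupports.
Import mathcomp.boot.fintype mathcomp.boot.finset.
Variables (R : realType) (W : groupType) (S : finType) (C : coxeter_system W S).
Local Open Scope ring_scope.

Local Notation V := (root_space R S).
Local Notation B := (@cox_form R W S C).
Local Notation alpha := (simple_root R).
Local Notation refl := (@reflection R W S C).
Local Notation act := (@word_act R W S C).
Local Notation gram := (@gram R W S C).
Local Notation wp := (word_prod (cgen C)).
Local Notation len := (clength C).
Local Notation e := (diagram C).

Lemma diagram_sym : symmetric e.
Proof. by move=> s t; rewrite /diagram eq_sym mcox_sym. Qed.

Lemma mcox_off_cases s t : s != t ->
  [\/ mcox C s t = 0%N, mcox C s t = 2 | (2 < mcox C s t)%N].
Proof.
move=> /(mcox_off C); case: (mcox C s t) => [|[|[|n]]] // _;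
  [exact: Or31|exact: Or32|exact: Or33].
Qed.

Lemma gram_le0 s t : s != t -> gram s t <= 0.
Proof.
move=> st; rewrite /gram; case: eqP => [_|/eqP m0]; first by rewrite lerN10.
rewrite oppr_le0; apply: cos_ge0_pihalf.
have m2 : 2 <= (mcox C s t)%:R :> R.
  by rewrite ler_nat; case: (mcox_off_cases st) m0 => [->//|->//|/ltnW].
have := pi_gt0 R; set m := (mcox C s t)%:R in m2 * => pi0.
have m_gt0 : 0 < m by lra.
have pim : pi / m <= pi / 2 by rewrite ler_pdivrMr //; nra.
have pim0 : 0 < pi / m by rewrite divr_gt0.
by set x := pi / m in pim pim0 *; apply/andP; split => //; lra.
Qed.

Lemma gram_lt0 s t : e s t -> gram s t < 0.
Proof.
move=> /andP[st]; rewrite /gram; case: eqP => [_ _|/eqP m0 /= m3].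
  by rewrite ltrN10.
rewrite oppr_lt0; apply: cos_gt0_pihalf.
have m2 : 3 <= (mcox C s t)%:R :> R by rewrite ler_nat.
have := pi_gt0 R; set m := (mcox C s t)%:R in m2 * => pi0.
have m_gt0 : 0 < m by lra.
have pim : pi / m < pi / 2 by rewrite ltr_pdivrMr //; nra.
have pim0 : 0 < pi / m by rewrite divr_gt0.
by set x := pi / m in pim pim0 *; apply/andP; split => //; lra.
Qed.

Lemma gram_neq0 s t : gram s t != 0 -> (s == t) || e s t.
Proof.
have [//|st] := eqVneq s t; rewrite /diagram st /=.
case: (mcox_off_cases st) => [-> //|m2|->]; last by rewrite orbT.
by rewrite /gram m2 /= cos_pihalf oppr0 eqxx.
Qed.

Definition root_support (a : V) : {set S} := [set t | a t != 0].

(** Distinct nodes that are not joined pair to zero, so some nonzero term comes from nodes that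
    coincide or are adjacent. *)
Lemma cox_form_neq0 a b : B a b != 0 ->
  exists s t, [/\ s \in root_support a, t \in root_support b & (s == t) || e s t].
Proof.
move=> ab; apply: contrapT => h; case/eqP: ab; rewrite /cox_form.
apply: big1 => s _; apply: big1 => t _; rewrite -/(gram s t); apply/eqP.
apply: contraT => st; case: h; exists s, t.
by move: st; rewrite !mulf_eq0 !negb_or !inE => /andP[/andP[-> ->] /gram_neq0].
Qed.

(** The two conditions share one induction: nonnegativity rules out cancellation, so supports of
    combinations are unions. *)
Definition good_root (a : V) : Prop :=
  (forall t, 0 <= a t) /\ induces_connected e (root_support a).

Lemma supportZ p a : p != 0 -> root_support (p *: a) = root_support a.
Proof.
by move=> p0; apply/setP => t; rewrite !inE scale_ffunE mulf_eq0 (negbTE p0).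
Qed.

Lemma support_scale0 a : root_support (0 *: a) = set0.
Proof. by apply/setP => t; rewrite !inE scale_ffunE mul0r eqxx. Qed.

Lemma good_rootZ p a : 0 <= p -> good_root a -> good_root (p *: a).
Proof.
move=> p0 [a0 ca]; split=> [t|]; first by rewrite scale_ffunE mulr_ge0.
have [->|pn0] := eqVneq p 0; last by rewrite supportZ.
by rewrite support_scale0; apply/forallP => x; rewrite inE.
Qed.

(** A nonzero pairing makes the supports touch; if a coefficient vanishes, at most one support is
    left. The second alternative serves orthogonal pairs. *)
Lemma good_root_comb p q a b : 0 <= p -> 0 <= q -> good_root a -> good_root b ->
  (B a b != 0) || (p * q == 0) -> good_root (p *: a + q *: b).
Proof.
move=> p0 q0 ga gb; have [->|pn0] := eqVneq p 0.
  by rewrite scale0r add0r => _; exact: good_rootZ.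
have [->|qn0] := eqVneq q 0.
  by rewrite scale0r addr0 => _; exact: good_rootZ.
rewrite mulf_eq0 (negbTE pn0) (negbTE qn0) !orbF.
move=> /cox_form_neq0[s [t [sa tb st]]].
have [[a0 ca] [b0 cb]] := (ga, gb).
split=> [r|]; first by rewrite lin_ffunE scale_ffunE addr_ge0 // mulr_ge0.
rewrite (_ : root_support _ = root_support a :|: root_support b).
  exact: (induces_connectedU diagram_sym ca cb sa tb st).
apply/setP => r; rewrite !inE lin_ffunE scale_ffunE.
rewrite paddr_eq0 ?mulr_ge0 // negb_and !mulf_eq0.
by rewrite (negbTE pn0) (negbTE qn0).
Qed.

Lemma support_simple s : root_support (alpha s) = [set s].
Proof.
by apply/setP => t; rewrite !inE simple_rootE pnatr_eq0 eqb0 negbK.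
Qed.

Lemma good_simple s : good_root (alpha s).
Proof.
split=> [t|]; first by rewrite simple_rootE ler0n.
by rewrite support_simple; exact: induces_connected1.
Qed.

(* [cheb c n] is [sin (n th) / sin th] when [c] is [cos th], and [n] when [c = 1]. *)
Fixpoint cheb (c : R) (n : nat) : R :=
  if n is n'.+1 then
    if n' is n''.+1 then 2 * c * cheb c n' - cheb c n'' else 1
  else 0.

Lemma chebSS c n : cheb c n.+2 = 2 * c * cheb c n.+1 - cheb c n.
Proof. by []. Qed.

Lemma cheb1 n : cheb 1 n = n%:R.
Proof.
suff : cheb 1 n = n%:R /\ cheb 1 n.+1 = n.+1%:R by case.
elim: n => [//|n [IH1 IH2]]; split => //; rewrite chebSS IH1 IH2.
by rewrite -!natr1; ring.
Qed.

Lemma cheb_cos th n : sin th * cheb (cos th) n = sin (n%:R * th).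
Proof.
suff : sin th * cheb (cos th) n = sin (n%:R * th) /\
       sin th * cheb (cos th) n.+1 = sin (n.+1%:R * th) by case.
elim: n => [|n [IH1 IH2]]; first by rewrite mulr0 mul0r sin0 mulr1 mul1r.
split=> //; rewrite chebSS mulrBr mulrCA IH1 IH2.
have -> : n.+2%:R * th = n.+1%:R * th + th by rewrite -[n.+2%:R]natr1; ring.
have nE : n%:R * th = n.+1%:R * th - th by rewrite -natr1; ring.
by rewrite nE sinB sinD; ring.
Qed.

(** This is the case [m = 2], where the cosine is [0]: it gives the side condition of
    [good_root_comb] for commuting generators. *)
Lemma cheb0_mul n : cheb 0 n * cheb 0 n.+1 = 0.
Proof.
elim: n => [|n IH]; rewrite ?mul0r //.
by rewrite chebSS mulr0 mul0r sub0r mulrN mulrC IH oppr0.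
Qed.

(** For finite [m] the sign is that of [sin (n pi / m)], with [n pi / m] in [[0, pi]]; for infinite
    [m] the value is [n]. *)
Lemma cheb_ge0 s t n : s != t ->
  (mcox C s t == 0%N) || (n <= mcox C s t)%N -> 0 <= cheb (- gram s t) n.
Proof.
move=> st; rewrite /gram; case: eqP => [_ _|/eqP m0 /= nm].
  by rewrite opprK cheb1 ler0n.
have m2 : (1 < mcox C s t)%N.
  by case: (mcox_off_cases st) m0 => [->//|->//|/ltnW].
rewrite opprK; set m := mcox C s t in m0 m2 nm *; pose th : R := pi / m%:R.
have mR : 0 < m%:R :> R by rewrite ltr0n lt0n.
have th0 : 0 < th by rewrite divr_gt0 // pi_gt0.
have thpi : th < pi by rewrite ltr_pdivrMr // ltr_pMr ?pi_gt0 // ltr1n.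
have s0 : 0 < sin th by rewrite sin_gt0_pi // thpi th0.
rewrite -(pmulr_rge0 _ s0) cheb_cos; apply: sin_ge0_pi.
apply/andP; split; first by rewrite mulr_ge0 ?ler0n // ltW.
by rewrite /th mulrA ler_pdivrMr // mulrC ler_wpM2l ?ler_nat ?pi_ge0.
Qed.

Lemma reflection_comb s t p q : refl t (p *: alpha s + q *: alpha t) =
  p *: alpha s + (2 * - gram s t * p - q) *: alpha t.
Proof.
apply/ffunP => r; rewrite reflection_coord !lin_ffunE !scale_ffunE.
rewrite cox_form_linl cox_formZl !cox_form_simple gram_diag !simple_rootE; ring.
Qed.

(** Each new letter replaces the older of the two coefficients by the next term of the recurrence of
    [cheb]. *)
Lemma alt_act s t k : act (alt t s k) (alpha s) =
  if odd k then cheb (- gram s t) k *: alpha s + cheb (- gram s t) k.+1 *: alpha t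
  else cheb (- gram s t) k.+1 *: alpha s + cheb (- gram s t) k *: alpha t.
Proof.
elim: k => [|k IH]; first by rewrite /= scale1r scale0r addr0.
rewrite alt_consS [act _ _]/= -/(act _ _) IH [odd k.+1]/= chebSS.
case: (odd k) => /=; last by rewrite reflection_comb.
by rewrite addrC reflection_comb [gram t s]gram_sym addrC.
Qed.

(* Write [w = v d] with [d] the longest alternating word in [s] and [t] that can
   be split off on the right without loss of length. Then [v] sends both
   [alpha s] and [alpha t] to good roots, and [d (alpha s)] is a nonnegative
   combination of them. *)
Lemma ascent_good_root u s : (len (wp u) < len (wp u * cgen C s)%g)%N ->
  good_root (act u (alpha s)).
Proof.
move: u s.
suff H n u s : (len (wp u) <= n)%N -> (len (wp u) < len (wp u * cgen C s)%g)%N ->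
  good_root (act u (alpha s)) by move=> u s; exact: H (leqnn _).
elim: n u s => [|n IH] u s un us.
  have [r ru] := clength_word C (wp u); move: un; rewrite leqn0 => /eqP -> /size0nil r0.
  by rewrite -(word_act_congr (alpha s) ru) r0; exact: good_simple.
have [r ru rlen] := clength_word C (wp u).
case/lastP: r => [|r t] in ru rlen *.
  by rewrite -(word_act_congr (alpha s) ru); exact: good_simple.
have st : s != t.
  have uE : wp u = (wp r * cgen C t)%g.
    by rewrite -ru -cats1 word_prod_cat word_prod1.
  apply: contraTneq us => ts; rewrite -leqNgt ts {1}uE mulgenK -rlen size_rcons.
  by rewrite (leq_trans (clength_le C r)).
pose P k := `[< exists2 v, wp (v ++ alt t s k) = wp u &
                (size v + k)%N = len (wp u) >].
have P1 : exists k, P k.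
  exists 1%N; apply/asboolP; exists r; first by rewrite cats1.
  by rewrite -rlen size_rcons addn1.
have Pmax k : P k -> (k <= len (wp u))%N.
  by move=> /asboolP[v _ <-]; exact: leq_addl.
case: (ex_maxnP P1 Pmax) => k /asboolP[v vu vlen] kmax.
have k_gt0 : (0 < k)%N.
  apply: kmax; apply/asboolP; exists r; first by rewrite cats1.
  by rewrite -rlen size_rcons addn1.
have lenv : len (wp v) = size v.
  apply/eqP; rewrite eqn_leq clength_le /=.
  have [v' vv' <-] := clength_word C (wp v).
  rewrite -(leq_add2r k) vlen -vu word_prod_cat -vv' -word_prod_cat.
  by rewrite (leq_trans (clength_le _ _)) // size_cat size_alt.
(* A descent [x] of [v] would either prolong the alternating suffix, against maximality of [k], or
   cancel its first letter and shorten a reduced word of [u]. *)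
have asc x : x \in [:: s; t] -> (len (wp v) < len (wp v * cgen C x)%g)%N.
  move=> xst; rewrite ltn_neqAle eq_sym clength_mulgen /= leqNgt; apply/negP.
  rewrite lenv; have [v' v'E <-] := clength_word C (wp v * cgen C x)%g => v'v.
  have uE : wp (v' ++ x :: alt t s k) = wp u.
    by rewrite word_prod_cat v'E word_prod_cons mulgA mulgenK -word_prod_cat.
  have [xk|xk] := eqVneq x (if odd k then s else t).
    have /kmax : P k.+1; last by rewrite ltnn.
    apply/asboolP; exists v'; first by rewrite alt_consS -xk.
    apply/eqP; rewrite eqn_leq -{2}uE (leq_trans (clength_le _ _)) ?andbT.
      by rewrite -vlen addnS -addSn leq_add2r.
    by rewrite size_cat /= size_alt.
  have xE : x = if odd k.-1 then s else t.
    case: k k_gt0 xk {kmax vu vlen uE} => //= k _.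
    by move: xst; rewrite !inE; case: odd => /= /orP[]/eqP->; rewrite ?eqxx.
  have : (len (wp u) < len (wp u))%N; last by rewrite ltnn.
  rewrite -{1}uE -[in alt _ _ k](prednK k_gt0) alt_consS -xE.
  rewrite word_prod_cat !word_prod_cons 2!mulgA mulgenK -word_prod_cat.
  rewrite (leq_ltn_trans (clength_le _ _)) // size_cat size_alt -vlen.
  by rewrite -[X in (_ < _ + X)%N](prednK k_gt0) addnS ltnS leq_add2r ltnW.
have lenvn : (len (wp v) <= n)%N.
  by rewrite lenv -ltnS (leq_trans _ un) // -vlen -addn1 leq_add2l.
have gs : good_root (act v (alpha s)).
  by apply: IH => //; apply: asc; rewrite mem_head.
have gt : good_root (act v (alpha t)).
  by apply: IH => //; apply: asc; rewrite !inE eqxx orbT.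
(* If [k] reached a finite [m], the suffix followed by [s] could be shortened, and [s] would not be
   an ascent of [u]. *)
have km : (mcox C s t == 0%N) || (k.+1 <= mcox C s t)%N.
  apply: contraLR us; rewrite negb_or -leqNgt -lt0n => mk; rewrite -leqNgt.
  rewrite -{1}vu -word_prod1 -word_prod_cat -catA cats1.
  rewrite -[rcons _ s]/(alt s t k.+1) word_prod_cat -vlen.
  have := alt_shorten (C := C) (s := s) (t := t) (k := k).
  rewrite mcox_sym => /(_ mk) sh.
  have [d dE dk] := clength_word C (wp (alt s t k.+1)).
  rewrite -dE -word_prod_cat (leq_trans (clength_le _ _)) // size_cat leq_add2l.
  by rewrite dk ltnW.
have c0 : 0 <= cheb (- gram s t) k.
  by apply: cheb_ge0 => //; case/orP: km => [->//|/ltnW ->]; rewrite orbT.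
have c1 : 0 <= cheb (- gram s t) k.+1 by apply: cheb_ge0.
have cc : (gram s t != 0) || (cheb (- gram s t) k * cheb (- gram s t) k.+1 == 0).
  by case: eqVneq => //= ->; rewrite oppr0 cheb0_mul.
rewrite -(word_act_congr (alpha s) vu) word_act_cat alt_act.
case: (odd k); rewrite word_act_lin word_actZ.
  by apply: good_root_comb; rewrite // word_act_form cox_form_simple.
by apply: good_root_comb; rewrite // word_act_form cox_form_simple // mulrC.
Qed.

Lemma supportN a : root_support (- a) = root_support a.
Proof. by apply/setP => t; rewrite !inE ffunE oppr_eq0. Qed.

Lemma rootsP a : Defs.roots C a <-> exists u s, a = act u (alpha s).
Proof.
split=> [[w [g [s [[u _ ->] ->]]]]|[u [s ->]]]; first by exists u, s.
by exists (wp u), (act u), s; split => //; exists u.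
Qed.

(** If [s] is a descent of [u], it is an ascent of [u] followed by [s], which sends [alpha s] to the
    opposite root, with the same support. *)
Lemma root_support_connected a : Defs.roots C a -> induces_connected e (root_support a).
Proof.
move=> /rootsP[u [s ->]].
have := clength_mulgen C (wp u) s; rewrite neq_ltn orbC => /orP[us|us].
  by case: (ascent_good_root us).
rewrite -supportN -word_actN -(reflection_simple _ C) -[refl s _]/(act [:: s] _).
rewrite -word_act_cat.
have [|//] := @ascent_good_root (u ++ [:: s]) s.
by rewrite word_prod_cat word_prod1 mulgenK.
Qed.

Lemma root_support_neq0 a : Defs.roots C a -> root_support a != set0.
Proof.
move=> /rootsP[u [s ->]]; apply/negP => /eqP/setP s0.
have : B (act u (alpha s)) (act u (alpha s)) = 0.
  rewrite /cox_form big1 // => x _; rewrite big1 // => y _.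
  by have := s0 x; rewrite !inE => /negbFE/eqP ->; rewrite !mul0r.
by rewrite word_act_form cox_form_simple gram_diag => /eqP; rewrite oner_eq0.
Qed.

Lemma simple_root_pos s : pos_roots C (alpha s).
Proof.
split; first by apply/rootsP; exists [::], s.
by move=> t; rewrite simple_rootE ler0n.
Qed.

(** The support grows inside [J] by one node at a time. For [q] adjacent to the support of a
    positive root [a], the pairing with [alpha q] is negative, so reflecting in [q] only changes the
    coordinate at [q], from zero to a positive value. *)
Lemma exists_root_support (J : {set S}) : J != set0 -> induces_connected e J ->
  exists2 a, pos_roots C a & root_support a = J.
Proof.
move=> /set0Pn[x xJ] cJ.
suff H n : (n < #|J|)%N -> exists2 a, pos_roots C a &
    root_support a \subset J /\ (n < #|root_support a|)%N.
  have J0 : (0 < #|J|)%N by rewrite card_gt0; apply/set0Pn; exists x.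
  have [|a pa [aJ na]] := H #|J|.-1; first by rewrite prednK.
  exists a => //; apply/eqP; rewrite eqEcard aJ /=.
  by rewrite prednK in na.
elim: n => [|n IH] nJ.
  exists (alpha x); first exact: simple_root_pos.
  by rewrite support_simple sub1set xJ cards1.
have [a [ra a0] [aJ na]] := IH (ltnW nJ).
have [na'|an] := ltnP n.+1 #|root_support a|; first by exists a.
have [p pa] : exists p, p \in root_support a by apply/set0Pn; exact: root_support_neq0.
have nJa : ~~ (J \subset root_support a).
  by apply: contraTN nJ => /subset_leq_card Ja; rewrite -leqNgt (leq_trans Ja).
have [p' [q [_ p'a qJ qa epq]]] :=
  induces_connected_exit cJ (subsetP aJ p pa) pa nJa.
have aq : a q = 0 by move: qa; rewrite inE negbK => /eqP.
have Bneg : B a (alpha q) < 0.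
  rewrite cox_form_sym cox_form_simplel (bigD1 p') //=.
  apply: (@le_lt_trans _ _ (a p' * gram q p')).
    rewrite gerDl sumr_le0 // => i _.
    have [->|iq] := eqVneq i q; first by rewrite aq mul0r.
    by rewrite mulr_ge0_le0 // gram_le0 // eq_sym.
  rewrite pmulr_rlt0; first by rewrite gram_lt0 // diagram_sym.
  by rewrite lt_def a0 andbT; rewrite inE in p'a.
have rc t : refl q a t = if t == q then - (2 * B a (alpha q)) else a t.
  rewrite reflection_coord; case: eqP => [->|_]; last by rewrite mulr0 subr0.
  by rewrite aq mulr1 sub0r.
have Bpos : 0 < - (2 * B a (alpha q)) by rewrite oppr_gt0 pmulr_rlt0.
exists (refl q a).
  split; last by move=> t; rewrite rc; case: eqP => // _; exact: ltW.
  move/rootsP: ra => [u [s ->]]; apply/rootsP; exists (q :: u), s; by [].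
have -> : root_support (refl q a) = q |: root_support a.
  apply/setP => t; rewrite !inE rc; case: (t =P q) => // _.
  by rewrite (gt_eqF Bpos).
by rewrite subUset sub1set qJ aJ cardsU1 qa.
Qed.

End RootSupports.

(** * Initial forms of roots with respect to a level *)

Definition lower_set (S : finType) (l : S -> nat) (i : nat) : {set S} :=
  [set s | l s < i].

Lemma in_lower_set (S : finType) (l : S -> nat) (i : nat) s :
  (s \in lower_set l i) = (l s < i).
Proof. by rewrite inE. Qed.

Section FlagMatroid.
Variables (R : realType) (W : groupType) (S : finType) (C : coxeter_system W S).
Local Open Scope classical_set_scope.
Local Open Scope ring_scope.

Local Notation V := (root_space R S).
Local Notation alpha := (simple_root R).
Local Notation e := (diagram C).
Local Notation Pos := (@pos_roots R W S C).
Local Notation Phi := (@pos_roots_in R W S C).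

Lemma mem_support (a : V) t : (t \in root_support a) = (a t != 0).
Proof. by rewrite inE. Qed.

Lemma root_space_sum (a : V) : a = \sum_s a s *: alpha s.
Proof.
apply/ffunP => t; rewrite sum_ffunE (bigD1 t) //= scale_ffunE simple_rootE eqxx.
rewrite mulr1 big1 ?addr0 // => s st.
by rewrite scale_ffunE simple_rootE eq_sym (negbTE st) mulr0.
Qed.

Lemma mem_span_simple (J : {set S}) (a : V) :
  (a \in <<[seq alpha s | s <- enum J]>>%VS) = (root_support a \subset J).
Proof.
apply/idP/fintype.subsetP => [|aJ].
  rewrite -[X in <<X>>%VS]/(tval (in_tuple _)) => /coord_span -> t.
  rewrite mem_support sum_ffunE; apply: contraNT => tJ; rewrite big1 // => i _.
  have : (in_tuple [seq alpha s | s <- enum J])`_i \in [seq alpha s | s <- enum J].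
    by rewrite mem_nth //=.
  move=> /mapP[s]; rewrite mem_enum => sJ ->.
  rewrite scale_ffunE simple_rootE; case: eqP => [ts|_]; last by rewrite mulr0.
  by rewrite ts sJ in tJ.
rewrite [a]root_space_sum; apply: memv_suml => s _.
have [->|as0] := eqVneq (a s) 0; first by rewrite scale0r mem0v.
apply: memvZ; apply: memv_span; apply/mapP; exists s => //.
by rewrite mem_enum aJ // mem_support.
Qed.

Lemma pos_roots_inP (J : {set S}) a : Phi J a <-> Pos a /\ root_support a \subset J.
Proof. by rewrite /pos_roots_in /= mem_span_simple. Qed.

(** Independence of a family indexed by [A]: two elements with the same image are dependent. *)
Definition lin_indep (f : V -> V) (A : set V) : Prop :=
  forall (X : seq V) (c : V -> R), uniq X -> [set` X] `<=` A ->
    \sum_(x <- X) c x *: f x = 0 -> forall x, x \in X -> c x = 0.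

Lemma uniq_freeP (X : seq V) : uniq X ->
  free X <-> (forall c : V -> R, \sum_(x <- X) c x *: x = 0 ->
                forall x, x \in X -> c x = 0).
Proof.
move=> uX; rewrite -[X in free X]/(tval (in_tuple X)); split.
  move=> /freeP fX c; rewrite (big_nth 0) big_mkord => /(fX (fun i => c X`_i)) cX x.
  by move=> /(nthP 0)[i iX <-]; exact: (cX (Ordinal iX)).
move=> H; apply/freeP => k kX i.
pose c x := if insub (index x X) is Some j then k j else 0.
have cE (j : 'I_(size X)) : c X`_j = k j.
  rewrite /c index_uniq //; case: insubP => [j' _ jj'|]; last by rewrite ltn_ord.
  by congr k; exact: val_inj.
rewrite -cE; apply: H; last by rewrite mem_nth.
by rewrite (big_nth 0) big_mkord -[RHS]kX; apply: eq_bigr => j _; rewrite cE.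
Qed.

Lemma mem_span_comb (X : seq V) v : uniq X -> v \in <<X>>%VS ->
  exists c : V -> R, v = \sum_(x <- X) c x *: x.
Proof.
move=> uX; rewrite -[X in <<X>>%VS]/(tval (in_tuple X)) => /coord_span vE.
pose c x := if insub (index x X) is Some j then coord (in_tuple X) j v else 0.
exists c; rewrite [LHS]vE (big_nth 0) big_mkord; apply: eq_bigr => j _.
rewrite /c index_uniq //; case: insubP => [j' _ jj'|]; last by rewrite ltn_ord.
by congr (coord _ _ _ *: _); apply: val_inj.
Qed.

Lemma lin_indepS f (A A' : set V) : A `<=` A' -> lin_indep f A' -> lin_indep f A.
Proof. by move=> AA' iA' X c uX XA; apply: iA' => // x /XA/AA'. Qed.

Lemma indep_root_matroid A :
  indep (root_matroid R C) A <-> A `<=` Pos /\ lin_indep id A.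
Proof.
split=> -[AP h]; split=> // X.
  by move=> c uX XA cX; exact: (uniq_freeP uX).1 (h X uX XA) c cX.
by move=> uX XA; apply/(uniq_freeP uX) => c cX; exact: (h X c).
Qed.

Lemma lin_indep_dep f (A : set V) (v : V) : lin_indep f A ->
  ~ lin_indep f (v |` A) ->
  exists X, [/\ uniq X, [set` X] `<=` A &
    exists c : V -> R, f v = \sum_(x <- X) c x *: f x].
Proof.
move=> iA niA; apply: contrapT => h; apply: niA => X c uX XvA cX.
pose X' := [seq x <- X | x != v].
have uX' : uniq X' by rewrite filter_uniq.
have X'A : [set` X'] `<=` A.
  by move=> x /=; rewrite mem_filter => /andP[xv /XvA[/eqP|//]]; rewrite (negbTE xv).
have XE : \sum_(x <- X) c x *: f x =
    (if v \in X then c v *: f v else 0) + \sum_(x <- X') c x *: f x.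
  rewrite big_filter; case: ifPn => vX; first by rewrite (bigD1_seq v).
  rewrite add0r [in RHS]big_seq_cond [LHS]big_seq; apply: eq_bigl => x.
  by case: eqP => [->|_]; rewrite ?andbT // andbF (negbTE vX).
have cv : v \in X -> c v = 0.
  move=> vX; apply: contrapT => /eqP cv; apply: h; exists X'; split => //.
  exists (fun x => - (c v)^-1 * c x).
  under eq_bigr do rewrite -scalerA.
  rewrite -scaler_sumr; move: cX; rewrite XE vX => /eqP; rewrite addrC addr_eq0.
  by move=> /eqP ->; rewrite scaleNr scalerN opprK scalerA mulVf // scale1r.
have X'0 : \sum_(x <- X') c x *: f x = 0.
  by move: cX; rewrite XE; case: ifP => [/cv ->|_]; rewrite ?scale0r add0r.
move=> x xX; have [xv|xv] := eqVneq x v; first by rewrite xv cv // -xv.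
by apply: (iA X' c uX' X'A X'0); rewrite mem_filter xv.
Qed.

Definition initial_form (l : S -> nat) (a : V) : V :=
  [ffun t => if [forall s in root_support a, (l s <= l t)%N] then a t else 0].

(** Linear substitute for [initial_form], which is not linear; the two agree on roots of top level
    [j]. *)
Definition level_proj (l : S -> nat) (j : nat) (a : V) : V :=
  [ffun t => if l t == j then a t else 0].

Lemma level_projE l j a t : level_proj l j a t = if l t == j then a t else 0.
Proof. by rewrite ffunE. Qed.

Lemma level_proj_sum l j (X : seq V) (c : V -> R) :
  level_proj l j (\sum_(x <- X) c x *: x) = \sum_(x <- X) c x *: level_proj l j x.
Proof.
apply/ffunP => t; rewrite level_projE !sum_ffunE; case: ifPn => lt.
  by apply: eq_bigr => x _; rewrite !scale_ffunE level_projE lt.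
by rewrite big1 // => x _; rewrite !scale_ffunE level_projE (negbTE lt) mulr0.
Qed.

(** Positive roots with top level at least [i] and below [j]: the ground set of a quotient. *)
Definition block (l : S -> nat) (i j : nat) : set V :=
  Phi (lower_set l j) `\` Phi (lower_set l i).

Lemma blockP l i j a : block l i j a <->
  [/\ Pos a, forall s, s \in root_support a -> (l s < j)%N &
      exists2 s, s \in root_support a & (i <= l s)%N].
Proof.
rewrite /block /=; split.
  move=> [/pos_roots_inP[Pa /fintype.subsetP aj] nai]; split => //.
    by move=> s /aj; rewrite in_lower_set.
  have /subsetPn[s sa] : ~~ (root_support a \subset lower_set l i).
    by apply/negP => ai; apply: nai; apply/pos_roots_inP.
  by rewrite in_lower_set -leqNgt; exists s.
move=> [Pa aj [s sa si]]; split.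
  apply/pos_roots_inP; split => //; apply/fintype.subsetP => r /aj.
  by rewrite in_lower_set.
move=> /pos_roots_inP[_ /fintype.subsetP/(_ s sa)].
by rewrite in_lower_set ltnNge si.
Qed.

Lemma initial_form_block l j a : block l j j.+1 a ->
  initial_form l a = level_proj l j a.
Proof.
move=> /blockP[_ aj [s sa js]]; apply/ffunP => t; rewrite !ffunE.
have ls : l s = j by apply/eqP; rewrite eqn_leq js andbT -ltnS aj.
have [->|at0] := eqVneq (a t) 0; first by rewrite !if_same.
have ta : t \in root_support a by rewrite mem_support.
case: eqP => [lt|/eqP lt].
  by rewrite ifT //; apply/forall_inP => r /aj; rewrite lt ltnS.
rewrite ifF //; apply/negP => /forall_inP/(_ s sa); rewrite ls => jt.
by case/negP: lt; rewrite eqn_leq jt andbT -ltnS aj.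
Qed.

End FlagMatroid.

(** * Quotients of a flag as matroids of initial forms *)

Section FlagMatroidTubes.
Variables (R : realType) (W : groupType) (S : finType) (C : coxeter_system W S).
Local Open Scope classical_set_scope.
Local Open Scope ring_scope.

Local Notation V := (root_space R S).
Local Notation alpha := (simple_root R).
Local Notation e := (diagram C).
Local Notation Pos := (@pos_roots R W S C).
Local Notation Phi := (@pos_roots_in R W S C).
Local Notation block := (@block R W S C).
Local Notation M := (root_matroid R C).
Local Notation init := (@initial_form R S).

Lemma simple_inj (s t : S) : alpha s = alpha t -> s = t.
Proof.
move/ffunP/(_ s); rewrite !simple_rootE eqxx; case: eqP => // _ /eqP.
by rewrite oner_eq0.
Qed.

Lemma lin_indep_simple (A : set V) : (forall a, A a -> exists s, a = alpha s) ->
  lin_indep id A.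
Proof.
move=> As X c uX XA cX x xX; have [s xs] := As x (XA x xX).
have := congr1 (fun v : V => v s) cX.
rewrite sum_ffunE (bigD1_seq x) //= scale_ffunE xs simple_rootE eqxx mulr1 ffunE.
rewrite big_seq_cond big1 ?addr0 // => y /andP[yX yx].
have [t yt] := As y (XA y yX); rewrite scale_ffunE yt simple_rootE.
case: eqP => [st|_]; last by rewrite mulr0.
by case/eqP: yx; rewrite yt st.
Qed.

Definition simple_below (l : S -> nat) (j : nat) : set V :=
  [set a | exists2 s, (l s < j)%N & a = alpha s].

Lemma simple_below_Phi l j : simple_below l j `<=` Phi (lower_set l j).
Proof.
move=> a [s sj ->]; apply/pos_roots_inP; split; first exact: simple_root_pos.
by rewrite support_simple finset.sub1set in_lower_set.
Qed.

Lemma Phi_simple_dep l j a : Phi (lower_set l j) a ->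
  ~ simple_below l j a -> ~ lin_indep id (a |` simple_below l j).
Proof.
move=> /pos_roots_inP[_ /fintype.subsetP aj] na iA.
pose L := [seq alpha s | s <- enum (lower_set l j)].
have aL : a \notin L.
  apply/negP => /mapP[s]; rewrite mem_enum in_lower_set => sj aE.
  by apply: na; exists s.
pose c x := if x == a then -1 else \sum_s x s * a s.
have uL : uniq (a :: L).
  by rewrite /= aL map_inj_uniq ?enum_uniq //; exact: simple_inj.
have LA : [set` a :: L] `<=` a |` simple_below l j.
  move=> x /=; rewrite inE => /orP[/eqP->|]; first by left.
  by move=> /mapP[s]; rewrite mem_enum in_lower_set => sj ->; right; exists s.
have cL : \sum_(x <- a :: L) c x *: x = 0.
  rewrite big_cons /c eqxx big_map big_enum /= scaleN1r; apply/eqP.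
  rewrite addrC subr_eq0; apply/eqP; rewrite [RHS]root_space_sum.
  rewrite [RHS](bigID (mem (lower_set l j))) /= [X in _ + X]big1 ?addr0.
    apply: eq_bigr => s sj; rewrite ifF; last first.
      apply/negP => /eqP sa; case/negP: aL; rewrite -sa; apply/mapP.
      by exists s => //; rewrite mem_enum.
    congr (_ *: _); rewrite (bigD1 s) //= simple_rootE eqxx mul1r big1 ?addr0 //.
    by move=> t ts; rewrite simple_rootE (negbTE ts) mul0r.
  move=> s; apply: contraNeq => as0; apply: aj; rewrite mem_support.
  by apply: contraNneq as0 => ->; rewrite scale0r.
have := iA _ c uL LA cL a; rewrite mem_head /c eqxx => /(_ isT)/eqP.
by rewrite oppr_eq0 oner_eq0.
Qed.

Lemma simple_below_basis l j k : (j <= k)%N ->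
  matroid_basis
    (matroid_restrict (matroid_restrict M (Phi (lower_set l k))) (Phi (lower_set l j)))
    (simple_below l j).
Proof.
move=> jk.
have Bk : simple_below l j `<=` Phi (lower_set l k).
  apply: subset_trans (@simple_below_Phi l k) => a [s sj ->]; exists s => //.
  exact: leq_trans jk.
split.
  split; last exact: simple_below_Phi; split=> //; apply/indep_root_matroid.
  split; first by move=> a /Bk/pos_roots_inP[].
  by apply: lin_indep_simple => a [s _ ->]; exists s.
move=> A [[/indep_root_matroid[_ iA] _] Aj] BA; apply/seteqP; split => // a Aa.
apply: contrapT => na; apply: (Phi_simple_dep (Aj a Aa) na).
by apply: lin_indepS iA => x [->|/BA].
Qed.

(** [matroid_contract] admits an arbitrary basis, known only to be maximal: adjoining a simple root
    outside [B] must create a dependence. *)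
Lemma basis_spans_simple l j k (B : set V) s : (j <= k)%N ->
  matroid_basis
    (matroid_restrict (matroid_restrict M (Phi (lower_set l k)))
      (Phi (lower_set l j))) B ->
  (l s < j)%N -> exists X, [/\ uniq X, [set` X] `<=` B & alpha s \in <<X>>%VS].
Proof.
move=> jk [[[/indep_root_matroid[BP iB] Bk] Bj] Bmax] sj.
have [Bs|nBs] := pselect (B (alpha s)).
  by exists [:: alpha s]; split=> // [x /=|]; rewrite ?span_seq1 ?memv_line //
    inE => /eqP->.
have Pj : simple_below l j (alpha s) by exists s.
have Pk : simple_below l k (alpha s) by exists s => //; exact: leq_trans jk.
have niB : ~ lin_indep id (alpha s |` B).
  move=> iB'; apply: nBs; rewrite -(Bmax (alpha s |` B)); first by left.
    split; last by move=> x [->|/Bj//]; exact: simple_below_Phi.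
    split; last by move=> x [->|/Bk//]; exact: simple_below_Phi.
    apply/indep_root_matroid; split=> // x [->|/BP//]; exact: simple_root_pos.
  by move=> x Bx; right.
have [X [uX XB [c sE]]] := lin_indep_dep iB niB.
exists X; split => //; rewrite [alpha s]sE big_seq; apply: memv_suml => x xX.
by apply: memvZ; exact: memv_span.
Qed.

(** Given a relation between initial forms, the same combination [y] of the roots has coordinates
    only below level [j]. So [y] is in the span of [B], which yields a relation on [A] and [B]. *)
Lemma contract_indep_initial l j (B A : set V) :
  matroid_basis
    (matroid_restrict (matroid_restrict M (Phi (lower_set l j.+1)))
      (Phi (lower_set l j))) B ->
  A `<=` block l j j.+1 -> lin_indep id (A `|` B) -> lin_indep (init l) A.
Proof.
move=> bB Ablk iAB X c uX XA cX.
pose y := \sum_(x <- X) c x *: x.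
have y_low t : y t != 0 -> (l t < j)%N.
  apply: contraNT; rewrite -leqNgt leq_eqVlt => /orP[/eqP jt|jt].
    have : level_proj l j y t = 0.
      rewrite /y level_proj_sum -[0 in RHS]/(0 : R) -[RHS](ffunE (fun=> 0 : R^o) t).
      rewrite (_ : \sum_(x <- X) _ = 0) ?ffunE // -[RHS]cX [LHS]big_seq [RHS]big_seq.
      by apply: eq_bigr => x /XA/Ablk/initial_form_block ->.
    by rewrite level_projE -jt eqxx => ->.
  rewrite /y sum_ffunE big_seq big1 // => x /XA/Ablk/blockP[_ xj _].
  rewrite scale_ffunE; have [->|xt] := eqVneq (x t) 0; first by rewrite mulr0.
  by have := xj t; rewrite mem_support xt => /(_ isT); rewrite ltnS leqNgt jt.
(* Each simple root below [j] needs finitely many elements of [B]; as [S] is finite, their union [Y]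
   is a finite list whose span contains [y]. *)
have /fin_all_exists[Z ZP] : forall s, exists X, [/\ uniq X, [set` X] `<=` B &
    (l s < j)%N -> alpha s \in <<X>>%VS].
  move=> s; have [sj|sj] := boolP (l s < j)%N; last by exists [::]; split.
  by have [X' [? ? ?]] := basis_spans_simple (leqnSn j) bB sj; exists X'.
pose Y := undup (flatten [seq Z s | s <- enum S]).
have YB : [set` Y] `<=` B.
  move=> x /=; rewrite mem_undup => /flattenP[z /mapP[s _ ->] xz].
  by have [_ + _] := ZP s; apply.
have /(mem_span_comb (undup_uniq _))[d yE] : y \in <<Y>>%VS.
  rewrite [y]root_space_sum; apply: memv_suml => s _.
  have [->|/y_low sj] := eqVneq (y s) 0; first by rewrite scale0r mem0v.
  apply: memvZ; have [_ _ /(_ sj)] := ZP s; apply/subvP/sub_span => x xs.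
  rewrite mem_undup; apply/flattenP; exists (Z s) => //.
  by apply/mapP; exists s => //; rewrite mem_enum.
have XY x : x \in X -> x \notin Y.
  move=> xX; apply/negP => /YB; move: bB => [[_ Bj] _] /Bj.
  by have [_] := Ablk _ (XA _ xX).
have uXY : uniq (X ++ Y).
  rewrite cat_uniq uX undup_uniq andbT /=; apply/hasPn => x xY.
  by apply/negP => /XY; rewrite xY.
move=> x xX; have := iAB (X ++ Y) (fun x => if x \in X then c x else - d x) uXY.
have XYAB : [set` X ++ Y] `<=` A `|` B.
  by move=> z /=; rewrite mem_cat => /orP[/XA|/YB]; [left|right].
move=> /(_ XYAB)/(_ _ x); rewrite mem_cat xX /=; apply => //.
rewrite big_cat /= (_ : \sum_(i <- X) _ = y); last first.
  by rewrite /y [LHS]big_seq [RHS]big_seq; apply: eq_bigr => z ->.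
rewrite [X in y + X](_ : _ = - y) ?subrr // yE -sumrN [LHS]big_seq [RHS]big_seq.
apply: eq_bigr => z zY; rewrite ifF ?scaleNr //.
by apply: contraTF zY => zX; exact: XY.
Qed.

(** Projection to level [j] kills the lower simple roots and gives initial forms on [A], so the
    coefficients on [A] vanish. What remains is a relation between simple roots. *)
Lemma initial_indep_contract l j (A : set V) :
  A `<=` block l j j.+1 -> lin_indep (init l) A ->
  lin_indep id (A `|` simple_below l j).
Proof.
move=> Ablk iA X c uX XAB cX.
have lowB x : simple_below l j x -> level_proj l j x = 0.
  move=> [s sj ->]; apply/ffunP => t; rewrite level_projE simple_rootE [RHS]ffunE.
  case: eqP => // lt; case: eqP => // ts.
  by rewrite ts in lt; rewrite lt ltnn in sj.
pose X1 := [seq x <- X | x \in A].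
have X1A : [set` X1] `<=` A by move=> x /=; rewrite mem_filter => /andP[/set_mem].
have c1 x : x \in X1 -> c x = 0.
  apply: (iA X1 c); rewrite ?filter_uniq //.
  have := congr1 (level_proj l j) cX; rewrite level_proj_sum.
  rewrite (bigID (mem A)) /= [X in _ + X]big_seq_cond [X in _ + X]big1 ?addr0.
    rewrite -big_filter (_ : level_proj l j 0 = 0); last first.
      by apply/ffunP => t; rewrite level_projE !ffunE if_same.
    rewrite -/X1 => E; rewrite -[RHS]E [LHS]big_seq [RHS]big_seq.
    by apply: eq_bigr => y /X1A/Ablk/initial_form_block ->.
  move=> y /andP[/XAB[Ay|/lowB ->]]; last by rewrite scaler0.
  by rewrite notin_setE.
pose X2 := [seq x <- X | x \notin A].
have c2 x : x \in X2 -> c x = 0.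
  have iB : lin_indep id (simple_below l j).
    by apply: lin_indep_simple => a [s _ ->]; exists s.
  apply: (iB X2 c); rewrite ?filter_uniq //.
    move=> y /=; rewrite mem_filter => /andP[yA /XAB[Ay|//]].
    by move: yA; rewrite notin_setE.
  rewrite big_filter; move: cX; rewrite (bigID (mem A)) /= -[X in X + _]big_filter.
  rewrite big_seq big1 ?add0r // => y yX1; by rewrite c1 ?scale0r.
move=> x xX; have [xA|xA] := boolP (x \in A); first by apply: c1; rewrite mem_filter xA.
by apply: c2; rewrite mem_filter xA.
Qed.

(** With [j = i.+1] this is one quotient of the flag; wider ranges are the direct sums of these. *)
Definition level_matroid (l : S -> nat) (i j : nat) : matroid V :=
  Matroid (block l i j) [set A | A `<=` block l i j /\ lin_indep (init l) A].

Lemma contract_level l j :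
  matroid_contract (matroid_restrict M (Phi (lower_set l j.+1))) (Phi (lower_set l j)) =
  level_matroid l j j.+1.
Proof.
have gE : (Pos `&` Phi (lower_set l j.+1)) `\` Phi (lower_set l j) = block l j j.+1.
  rewrite /block (_ : Pos `&` _ = Phi (lower_set l j.+1)) //.
  by apply/seteqP; split => [a []//|a aj]; split => //; case/pos_roots_inP: aj.
rewrite /matroid_contract /level_matroid; congr Matroid; first exact: gE.
apply/seteqP; split => A /=; rewrite -/(Pos) gE.
  move=> [Ablk [B bB [/indep_root_matroid[_ iAB] _]]]; split => //.
  exact: contract_indep_initial bB Ablk iAB.
move=> [Ablk iA]; split => //; exists (simple_below l j).
  exact: simple_below_basis.
have Bj1 : simple_below l j `<=` Phi (lower_set l j.+1).
  by move=> a [s sj ->]; apply: simple_below_Phi; exists s => //; exact: ltnW.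
split; last by move=> x [/Ablk[]//|/Bj1].
apply/indep_root_matroid; split; last exact: initial_indep_contract.
by move=> x [/Ablk/blockP[]//|/Bj1/pos_roots_inP[]].
Qed.

End FlagMatroidTubes.

(** * The matroid of a flag and its tubes determine each other *)

Section FlagMatroidLevels.
Variables (R : realType) (W : groupType) (S : finType) (C : coxeter_system W S).
Local Open Scope classical_set_scope.
Local Open Scope ring_scope.

Local Notation V := (root_space R S).
Local Notation alpha := (simple_root R).
Local Notation e := (diagram C).
Local Notation Pos := (@pos_roots R W S C).
Local Notation Phi := (@pos_roots_in R W S C).
Local Notation block := (@block R W S C).
Local Notation M := (root_matroid R C).
Local Notation init := (@initial_form R S).
Local Notation level_matroid := (@level_matroid R W S C).

Lemma block_cat l i j k : (i <= j <= k)%N ->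
  block l i j `|` block l j k = block l i k.
Proof.
move=> /andP[ij jk]; apply/seteqP; split => a.
  case=> /blockP[Pa aj [s sa is_]]; apply/blockP; split => //.
  - by move=> t /aj tj; exact: leq_trans jk.
  - by exists s.
  - by exists s => //; exact: leq_trans is_.
move=> /blockP[Pa aj [s sa is_]].
have [[t ta jt]|h] := pselect (exists2 t, t \in root_support a & (j <= l t)%N).
  by right; apply/blockP; split => //; exists t.
left; apply/blockP; split => //; last by exists s.
by move=> t ta; rewrite ltnNge; apply/negP => jt; apply: h; exists t.
Qed.

Lemma initial_form_neq0 l a t : init l a t != 0 ->
  t \in root_support a /\ forall s, s \in root_support a -> (l s <= l t)%N.
Proof.
rewrite ffunE; case: ifP => [/forall_inP h at0|_]; last by rewrite eqxx.
by split => //; rewrite mem_support.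
Qed.

(** Initial forms of different top levels have disjoint sets of coordinates, so a relation
    splits. *)
Lemma initial_indepU l j k (A B : set V) : A `<=` block l j j.+1 ->
  B `<=` block l j.+1 k -> lin_indep (init l) A -> lin_indep (init l) B ->
  lin_indep (init l) (A `|` B).
Proof.
move=> Ablk Bblk iA iB X c uX XAB cX.
pose X1 := [seq x <- X | x \in A]; pose X2 := [seq x <- X | x \notin A].
have X1A : [set` X1] `<=` A by move=> x /=; rewrite mem_filter => /andP[/set_mem].
have X2B : [set` X2] `<=` B.
  move=> x /=; rewrite mem_filter => /andP[/negP xA /XAB[Ax|//]].
  by case: xA; exact: mem_set.
have XE t : \sum_(x <- X1) c x * init l x t + \sum_(x <- X2) c x * init l x t = 0.
  have := congr1 (fun v : V => v t) cX.
  rewrite sum_ffunE ffunE (bigID (mem A)) /= => E; rewrite -[RHS]E !big_filter.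
  by congr (_ + _); apply: eq_bigr => x _; rewrite scale_ffunE.
have s1 : \sum_(x <- X1) c x *: init l x = 0.
  apply/ffunP => t; rewrite sum_ffunE [RHS]ffunE.
  under eq_bigr do rewrite scale_ffunE.
  have [lt|lt] := eqVneq (l t) j.
    have := XE t; rewrite [X in _ + X]big_seq [X in _ + X]big1 ?addr0 //.
    move=> x /X2B/Bblk/blockP[_ _ [s sx js]]; apply/eqP; apply: contraT.
    rewrite mulf_eq0 negb_or => /andP[_ /initial_form_neq0[_ /(_ s sx)]].
    by rewrite lt leqNgt js.
  rewrite big_seq big1 // => x /X1A/Ablk bx; rewrite (initial_form_block bx).
  by rewrite level_projE (negbTE lt) mulr0.
have c1 x : x \in X1 -> c x = 0 by apply: (iA X1 c); rewrite ?filter_uniq.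
have c2 x : x \in X2 -> c x = 0.
  apply: (iB X2 c) => //; rewrite ?filter_uniq //.
  apply/ffunP => t; rewrite sum_ffunE [RHS]ffunE.
  under eq_bigr do rewrite scale_ffunE.
  have := XE t; rewrite [X in X + _]big_seq [X in X + _]big1 ?add0r //.
  by move=> y /c1 ->; rewrite mul0r.
move=> x xX; have [xA|xA] := boolP (x \in A); first by apply: c1; rewrite mem_filter xA.
by apply: c2; rewrite mem_filter xA.
Qed.

Lemma level_matroid_sum l j k : (j < k)%N ->
  matroid_sum (level_matroid l j j.+1) (level_matroid l j.+1 k) =
  level_matroid l j k.
Proof.
move=> jk; have bE : block l j j.+1 `|` block l j.+1 k = block l j k.
  by rewrite block_cat // leqnSn.
rewrite /matroid_sum /level_matroid /=; congr Matroid; first exact: bE.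
apply/seteqP; split => A /=.
  move=> [X [Y [[Xb iX] [Yb iY] ->]]]; split; last exact: (initial_indepU Xb Yb iX iY).
  by rewrite -bE => x [/Xb|/Yb]; [left|right].
move=> [Ab iA]; exists (A `&` block l j j.+1), (A `&` block l j.+1 k); split.
- by split=> [x []//|]; apply: lin_indepS iA => x [].
- by split=> [x []//|]; apply: lin_indepS iA => x [].
by rewrite -setIUr bE; apply/esym/setIidl.
Qed.

Lemma level_matroid0 l j : level_matroid l j j = matroid_empty V.
Proof.
have b0 : block l j j = set0 by exact: setDv.
rewrite /level_matroid b0 /matroid_empty; congr Matroid; apply/seteqP; split => A /=.
  by move=> [A0 _]; apply/seteqP; split.
move=> ->; split=> // X c _ X0 _ x xX; by have := X0 x xX.
Qed.

Lemma level_flag l j n :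
  foldr (@matroid_sum V) (matroid_empty V)
    (pairmap (fun G F => matroid_contract (matroid_restrict M F) G)
      (Phi (lower_set l j)) [seq Phi (lower_set l i) | i <- iota j.+1 n]) =
  level_matroid l j (j + n).
Proof.
elim: n j => [|n IH] j; first by rewrite addn0 level_matroid0.
by rewrite /= IH contract_level addSn level_matroid_sum ?addnS // ltnS leq_addr.
Qed.

Lemma Phi_lower_full l k : (forall s, (l s < k)%N) -> Phi (lower_set l k) = Pos.
Proof.
move=> lk; apply/seteqP; split => [a /pos_roots_inP[]//|a Pa].
apply/pos_roots_inP; split => //; apply/fintype.subsetP => s _.
by rewrite in_lower_set.
Qed.

Lemma Phi_lower0 l : Phi (lower_set l 0) = set0.
Proof.
apply/seteqP; split => // a /pos_roots_inP[[ra _] /fintype.subsetP a0].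
have /set0Pn[s /a0] := root_support_neq0 ra.
by rewrite in_lower_set.
Qed.

Lemma matroid_of_level_flag l k : (forall s, (l s <= k)%N) ->
  matroid_of_flag M [seq Phi (lower_set l i) | i <- iota 1 k] =
  level_matroid l 0 k.+1.
Proof.
move=> lk; rewrite /matroid_of_flag -[in LHS](Phi_lower0 l).
rewrite -[ground _]/Pos -(@Phi_lower_full l k.+1) // -map_rcons -cats1.
by rewrite -[[:: k.+1]]/(iota (1 + k) 1) -iotaD addn1 level_flag.
Qed.

Lemma block_full l k : (forall s, (l s <= k)%N) -> block l 0 k.+1 = Pos.
Proof.
by move=> lk; rewrite /block Phi_lower0 Phi_lower_full // setD0.
Qed.

Lemma initial_form_tubes l l' a : Pos a -> level_tubes e l = level_tubes e l' ->
  init l a = init l' a.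
Proof.
move=> [ra _] ll'; apply/ffunP => t; rewrite !ffunE.
have [->|at0] := eqVneq (a t) 0; first by rewrite !if_same.
have ta : t \in root_support a by rewrite mem_support.
have ca := root_support_connected ra.
have mx := max_levelP (diagram_sym C) _ ca ta.
suff -> : [forall s in root_support a, l s <= l t]%N =
          [forall s in root_support a, l' s <= l' t]%N by [].
by apply/forall_inP/forall_inP => /mx h; apply/mx; rewrite ?ll' // -ll'.
Qed.

(** If [J] is a tube of [l] but not of [l'], some neighbour [r] of [J] is not above the [l']-top
    [t0] of [J]. Let the root [a] have support [J] and [r]. Under [l] its initial form is a multiple
    of [alpha r]; under [l'] it has a nonzero coordinate at [t0]. So [a] and [alpha r] are dependent
    for [l] and independent for [l']. *)
Lemma level_matroid_tubes_sub l l' k k' :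
  (forall s, (l s <= k)%N) -> (forall s, (l' s <= k')%N) ->
  level_matroid l 0 k.+1 = level_matroid l' 0 k'.+1 ->
  level_tubes e l \subset level_tubes e l'.
Proof.
move=> lk lk' ME; apply/fintype.subsetP => J Jl; apply: contraT => nJl'.
have /level_tubesP[tJ Jlt] := Jl.
have [t [q [r [tJ' qJ rJ eqr rt]]]] : exists t q r,
    [/\ t \in J, q \in J, r \notin J, e q r & (l' r <= l' t)%N].
  apply: contrapT => h; case/negP: nJl'; apply/level_tubesP; split => //.
  move=> t q r tJ' qJ rJ eqr; rewrite ltnNge; apply/negP => rt; apply: h.
  by exists t, q, r.
have [J0 _ cJ] := and3P tJ.
have [t0 t0J t0max] : exists2 t0, t0 \in J & forall s, s \in J -> (l' s <= l' t0)%N.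
  by case: (arg_maxnP l' tJ') => t0 ? ?; exists t0.
have rt0 : (l' r <= l' t0)%N by apply: leq_trans rt _; exact: t0max.
have cJr : induces_connected e (J :|: finset.set1 r).
  apply: (induces_connectedU (diagram_sym C) cJ (induces_connected1 _ r) qJ
    (finset.set11 r)).
  by rewrite eqr orbT.
have Jr0 : J :|: finset.set1 r != finset.set0.
  by apply/set0Pn; exists q; rewrite inE qJ.
have [a Pa aJ] := exists_root_support R Jr0 cJr.
have ina s : (s \in root_support a) = (s \in J) || (s == r) by rewrite aJ !inE.
have ar : a r != 0 by rewrite -mem_support ina eqxx orbT.
have at0 : a t0 != 0 by rewrite -mem_support ina t0J.
have t0r : t0 != r by apply: contraNneq rJ => <-.
have aNr : a != alpha r.
  by apply: contraNneq at0 => ->; rewrite simple_rootE (negbTE t0r).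
have initr m : init m (alpha r) = alpha r.
  apply/ffunP => s; rewrite ffunE simple_rootE.
  case: eqP => [->|_]; last by rewrite if_same.
  by rewrite ifT //; apply/forall_inP => x; rewrite support_simple inE => /eqP ->.
have initla : init l a = a r *: alpha r.
  apply/ffunP => s; rewrite ffunE scale_ffunE simple_rootE.
  have [->|sr] := eqVneq s r.
    rewrite mulr1 ifT //; apply/forall_inP => x; rewrite ina => /orP[xJ|/eqP->//].
    exact/ltnW/(Jlt x q r).
  rewrite mulr0; case: ifP => // /forall_inP h; apply/eqP; apply: contraT.
  rewrite -mem_support ina (negbTE sr) orbF => sJ.
  have := h r; rewrite ina eqxx orbT => /(_ isT).
  by rewrite leqNgt (Jlt s q r).
have initl'a : init l' a t0 = a t0.
  rewrite ffunE ifT //; apply/forall_inP => x; rewrite ina => /orP[/t0max//|/eqP->//].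
pose A : set V := [set x | x = a \/ x = alpha r].
have AP : A `<=` Pos by move=> x [->//|->]; exact: simple_root_pos.
have iA : indep (level_matroid l' 0 k'.+1) A.
  split=> [|X c uX XA cX]; first by rewrite block_full.
  have ca : a \in X -> c a = 0.
    move=> aX; have := congr1 (fun v : V => v t0) cX.
    rewrite sum_ffunE (bigD1_seq a) //= big_seq_cond big1.
      rewrite addr0 scale_ffunE initl'a [RHS]ffunE => /eqP.
      by rewrite mulf_eq0 (negbTE at0) orbF => /eqP.
    move=> x /andP[/XA[->|->]]; first by rewrite eqxx.
    by rewrite initr scale_ffunE simple_rootE (negbTE t0r) mulr0.
  move=> x xX; have [xa|xr] := XA x xX; first by rewrite xa ca // -xa.
  have := congr1 (fun v : V => v r) cX.
  rewrite sum_ffunE (bigD1_seq x) //= big_seq_cond big1.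
    by rewrite addr0 scale_ffunE xr initr simple_rootE eqxx mulr1 [RHS]ffunE.
  move=> y /andP[yX yx]; have [ya|yr] := XA y yX; last by rewrite yr -xr eqxx in yx.
  by rewrite ya ca -?ya // scale0r ffunE.
have : indep (level_matroid l 0 k.+1) A by rewrite ME.
move=> [_ iAl].
pose c (x : V) : R := if x == a then 1 else - a r.
have uX : uniq [:: a; alpha r] by rewrite /= inE aNr.
have XA : [set` [:: a; alpha r]] `<=` A.
  by move=> x /=; rewrite !inE => /orP[]/eqP->; [left|right].
have cX : \sum_(x <- [:: a; alpha r]) c x *: init l x = 0.
  rewrite big_cons big_seq1 /c eqxx eq_sym (negbTE aNr) initr initla scale1r.
  by rewrite scaleNr subrr.
have := iAl _ c uX XA cX a; rewrite mem_head /c eqxx => /(_ isT)/eqP.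
by rewrite oner_eq0.
Qed.

Lemma level_matroid_tubes l l' k k' :
  (forall s, (l s <= k)%N) -> (forall s, (l' s <= k')%N) ->
  level_matroid l 0 k.+1 = level_matroid l' 0 k'.+1 <->
  level_tubes e l = level_tubes e l'.
Proof.
move=> lk lk'; split => [ME|TE].
  apply/eqP; rewrite finset.eqEsubset.
  rewrite (level_matroid_tubes_sub lk lk' ME).
  by rewrite (level_matroid_tubes_sub lk' lk (esym ME)).
rewrite /level_matroid !block_full //; congr Matroid; apply/seteqP.
by split=> A /= [AP iA]; split=> // X c uX XA cX; apply: (iA X c) => //;
  rewrite -[RHS]cX [LHS]big_seq [RHS]big_seq; apply: eq_bigr => x /XA/AP Px;
  rewrite (initial_form_tubes Px TE).
Qed.

End FlagMatroidLevels.

(** * Levels made consecutive *)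

Section LevelRank.
Import mathcomp.boot.fintype mathcomp.boot.finset.
Variables (S : finType) (l : S -> nat).

(** Smaller values of [l] are counted by their fibres. Ranks leave no gaps, so their sublevel sets
    form a strict chain. *)
Definition level_rank (s : S) : nat :=
  #|[set [set x | l x == l t] | t in [set t | l t < l s]]|.

Lemma level_rank_lt s t : (level_rank s < level_rank t) = (l s < l t).
Proof.
have cls a b : [set x | l x == l a] = [set x | l x == l b] -> l a = l b.
  by move=> /setP/(_ a); rewrite !inE eqxx => /esym/eqP.
have mono a b : l a <= l b -> level_rank a <= level_rank b.
  move=> ab; apply/subset_leq_card/subsetP => X /imsetP[u]; rewrite inE => ua ->.
  by apply: imset_f; rewrite inE (leq_trans ua).
apply/idP/idP => [|st]; first by apply: contraTT; rewrite -!leqNgt; exact: mono.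
apply: proper_card; apply/properP; split.
  apply/subsetP => X /imsetP[x]; rewrite inE => xs ->.
  by apply: imset_f; rewrite inE (ltn_trans xs).
exists [set x | l x == l s]; first by apply: imset_f; rewrite inE.
by apply/imsetP => -[x]; rewrite inE => xs /cls E; rewrite E ltnn in xs.
Qed.

Lemma level_rank_onto s j : j <= level_rank s -> exists t, level_rank t = j.
Proof.
elim: (level_rank s) {-2}s (leqnn (level_rank s)) => [|n IH] {}s sn.
  by move=> js; exists s; lia.
rewrite leq_eqVlt => /orP[/eqP ->|js]; first by exists s.
have [E|[r]] := set_0Vmem [set t | l t < l s].
  by move: js; rewrite /level_rank E imset0 cards0.
(* [t] is highest below [s]: its fibre is the only one counted for [s] and not for [t], so its rank
   is one less. *)
rewrite inE => rs; case: (@arg_maxnP _ r (fun t => l t < l s) l rs) => t ts tmax.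
have E : level_rank s = (level_rank t).+1.
  rewrite /level_rank -add1n.
  set A := (X in _ = 1 + #|X|).
  have -> : 1 = ([set x | l x == l t] \notin A).
    by case: imsetP => // -[x]; rewrite inE => xt /setP/(_ t);
       rewrite !inE eqxx => /esym/eqP E; rewrite E ltnn in xt.
  rewrite -cardsU1; congr (#|pred_of_set _|); apply/setP => X.
  apply/imsetP/setU1P => [[x]|[->|/imsetP[x]]].
  - rewrite inE => xs ->; have : l x <= l t := tmax x xs.
    rewrite leq_eqVlt => /orP[/eqP->|xt].
      by left.
    by right; apply: imset_f; rewrite inE.
  - by exists t; rewrite ?inE.
  - by rewrite inE => xt ->; exists x => //; rewrite inE (ltn_trans xt).
by apply: (IH t); move: sn js; rewrite E.
Qed.

End LevelRank.

(** * Positive flats as sets of nodes *)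

Section Flags.
Variables (R : realType) (W : groupType) (S : finType) (C : coxeter_system W S).
Local Open Scope classical_set_scope.
Local Open Scope ring_scope.

Local Notation V := (root_space R S).
Local Notation alpha := (simple_root R).
Local Notation e := (diagram C).
Local Notation Pos := (@pos_roots R W S C).
Local Notation Phi := (@pos_roots_in R W S C).
Local Notation M := (root_matroid R C).

(** A functional whose covector is nonnegative with zero set [Phi J]. *)
Definition outer_sum (J : {set S}) (a : V) : R := \sum_(s | s \notin J) a s.

Lemma outer_sum_linear J : linear_for *%R (outer_sum J).
Proof.
move=> c u v; rewrite /outer_sum mulr_sumr -big_split; apply: eq_bigr => s _.
by rewrite lin_ffunE.
Qed.

HB.instance Definition _ J :=
  GRing.isLinear.Build R V R *%R (outer_sum J) (outer_sum_linear J).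

Lemma Phi_simple J s : Phi J (alpha s) <-> s \in J.
Proof.
rewrite pos_roots_inP support_simple finset.sub1set; split=> [[]//|sJ].
by split => //; exact: simple_root_pos.
Qed.

Lemma Phi_inj : injective Phi.
Proof.
move=> J J' E; apply/finset.setP => s.
by apply/idP/idP => /(Phi_simple _ _).2; [rewrite E|rewrite -E] => /Phi_simple.
Qed.

(** A functional nonnegative on simple roots vanishes on a positive root only if it vanishes on
    every simple root of the support. Conversely, [Phi J] is parabolic with [w = 1]. *)
Lemma positive_flatP F : positive_flat C F <-> exists J, F = Phi J.
Proof.
split.
  move=> [_ [X [[f XE] X0 FE]]].
  have f0 s : 0 <= f (alpha s).
    have Ps := simple_root_pos R C s; have := X0 _ Ps.
    by rewrite XE mem_set // sgz_ge0.
  have fE (a : V) : f a = \sum_s a s * f (alpha s).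
    rewrite {1}[a]root_space_sum raddf_sum; apply: eq_bigr => s _.
    exact: scalarZ.
  pose J : {set S} := finset.finset (fun s => f (alpha s) == 0).
  have inJ s : (s \in J) = (f (alpha s) == 0) by rewrite inE.
  exists J; rewrite FE; apply/seteqP; split => a /=.
    move=> [Pa]; rewrite XE mem_set // => /eqP; rewrite sgz_eq0 fE => fa.
    apply/pos_roots_inP; split => //; apply/fintype.subsetP => s.
    rewrite mem_support inJ => as0; move: fa; rewrite psumr_eq0.
      by move=> /allP/(_ s (mem_index_enum s)); rewrite mulf_eq0 (negbTE as0).
    by move=> t _; apply: mulr_ge0 => //; exact: Pa.2.
  move=> /pos_roots_inP[Pa /fintype.subsetP aJ]; split => //.
  rewrite XE mem_set //; apply/eqP; rewrite sgz_eq0 fE; apply/eqP; apply: big1 => s _.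
  have [->|as0] := eqVneq (a s) 0; first by rewrite mul0r.
  by have := aJ s; rewrite mem_support as0 inJ => /(_ isT)/eqP ->; rewrite mulr0.
move=> [J ->]; split.
  exists 1%g, id, J; split; last by rewrite image_id.
    move=> x _; have <- : word_prod (cgen C) [::] = 1%g by rewrite /word_prod big_nil.
    by apply: leq_trans (clength_le C [::]) _.
  by exists [::]; rewrite // /word_prod big_nil.
exists (fun a => if a \in Pos then sgz (outer_sum J a) else 0); split.
- by exists (outer_sum J).
- move=> a Pa; rewrite mem_set // sgz_ge0; apply: sumr_ge0 => s _; exact: Pa.2.
apply/seteqP; split => a /=.
  move=> /pos_roots_inP[Pa /fintype.subsetP aJ]; split => //; rewrite mem_set //.
  apply/eqP; rewrite sgz_eq0 /outer_sum big1 // => s sJ; apply/eqP.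
  by apply: contraNT sJ; rewrite -mem_support; exact: aJ.
move=> [Pa]; rewrite mem_set // => /eqP; rewrite sgz_eq0 /outer_sum psumr_eq0.
  move=> /allP h; apply/pos_roots_inP; split => //; apply/fintype.subsetP => s.
  rewrite mem_support; apply: contraNT => sJ.
  by have := h s (mem_index_enum s); rewrite sJ.
by move=> s _; exact: Pa.2.
Qed.

End Flags.

(** * Flags as level functions *)

(** Earlier entries inherit [p], so those satisfying it form an initial segment. *)
Lemma nth_count_sorted (T : Type) (p : pred T) (r : rel T) x0 xs i :
  transitive r -> (forall x y, r x y -> p y -> p x) -> sorted r xs ->
  i < size xs -> p (nth x0 xs i) = (i < count p xs).
Proof.
move=> tr rp; elim: xs i => [|x xs IH] i //= pxs.
have xr := order_path_min tr pxs.
have [px|px] := boolP (p x).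
  by case: i => //= i isz; rewrite IH // (path_sorted pxs).
have np : ~~ has p xs.
  rewrite has_count -leqNgt leqn0 -(count_pred0 xs); apply/eqP.
  elim: xs xr {IH pxs} => //= y ys IHy /andP[xy xys]; rewrite IHy //.
  by rewrite (negbTE (contra (rp _ _ xy) px)).
have -> : count p xs = 0 by apply/eqP; rewrite -leqn0 leqNgt -has_count.
case: i => [|i] /= isz; first by rewrite (negbTE px).
elim: xs i isz np {IH pxs xr} => //= y ys IHy [|i] isz /norP[py pys].
  by rewrite (negbTE py).
exact: IHy.
Qed.

Section FlagLevels.
Variables (R : realType) (W : groupType) (S : finType) (C : coxeter_system W S).
Local Open Scope classical_set_scope.
Local Open Scope ring_scope.

Local Notation V := (root_space R S).
Local Notation alpha := (simple_root R).
Local Notation e := (diagram C).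
Local Notation Pos := (@pos_roots R W S C).
Local Notation Phi := (@pos_roots_in R W S C).
Local Notation M := (root_matroid R C).

(** In a flag the flats missing [alpha s] come first, so the [i]-th flat, counted from [1], contains
    [alpha s] iff this number is below [i]. *)
Definition flag_level (Fs : seq (set V)) (s : S) : nat :=
  count (fun F : set V => ~~ `[< F (alpha s) >]) Fs.

Definition flag_tubes (Fs : seq (set V)) : {set {set S}} :=
  level_tubes e (flag_level Fs).

Lemma flag_level_map l k s : (l s <= k)%N ->
  flag_level [seq Phi (lower_set l i) | i <- iota 1 k] s = l s.
Proof.
rewrite /flag_level count_map.
have cE n : count (fun i => ~~ (l s < i)%N) (iota 1 n) = minn (l s) n.
  elim: n => [|n IH]; first by rewrite minn0.
  by rewrite -(addn1 n) iotaD count_cat IH /= addn0; lia.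
move=> sk; rewrite -[RHS](minn_idPl sk) -cE; apply: eq_count => i /=; congr (~~ _).
by apply/asboolP/idP => [/Phi_simple|si]; [|apply/Phi_simple];
  rewrite in_lower_set.
Qed.

Lemma properset_trans : transitive (fun F G : set V => `[< F `<` G >]).
Proof.
move=> B A D /asboolP[AB nBA] /asboolP[BD nDB]; apply/asboolP; split.
  exact: subset_trans BD.
by move=> DA; apply: nDB; exact: subset_trans DA AB.
Qed.

Lemma flag_pairwise (Fs : seq (set V)) : positive_flag C Fs ->
  sorted (fun F G : set V => `[< F `<` G >]) Fs /\
  forall F, F \in Fs -> set0 `<` F /\ F `<` Pos.
Proof.
move=> [_ sFs _]; move: (sFs); rewrite (sorted_pairwise properset_trans) /=.
rewrite all_rcons pairwise_rcons => /andP[/andP[_ /allP h0] /andP[/allP h1 hp]].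
split; first by rewrite (sorted_pairwise properset_trans).
by move=> F FFs; split; apply/asboolP; [exact: h0|exact: h1].
Qed.

Lemma flag_uniq (Fs : seq (set V)) : positive_flag C Fs -> uniq Fs.
Proof.
move=> /flag_pairwise[sFs _]; apply: sorted_uniq sFs; first exact: properset_trans.
by move=> F; apply/negbTE/negP => /asboolP[_]; apply.
Qed.

Lemma positive_flag_levels (Fs : seq (set V)) : positive_flag C Fs ->
  Fs = [seq Phi (lower_set (flag_level Fs) i) | i <- iota 1 (size Fs)].
Proof.
move=> fFs; have [_ _ flatF] := fFs; have [sFs _] := flag_pairwise fFs.
apply: (@eq_from_nth _ set0); first by rewrite size_map size_iota.
move=> i iFs; rewrite (nth_map 0%N) ?size_iota // nth_iota // add1n.
have /positive_flatP[J FJ] := flatF _ (mem_nth set0 iFs).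
rewrite FJ; congr (Phi _); apply/finset.setP => s; rewrite in_lower_set ltnS.
have /(_ set0 Fs i properset_trans) := @nth_count_sorted _
  (fun F : set V => ~~ `[< F (alpha s) >]) (fun F G : set V => `[< F `<` G >]).
rewrite FJ -/(flag_level Fs s) => E; rewrite leqNgt -E //.
  by rewrite negbK; apply/idP/asboolP => [sJ|/Phi_simple//]; exact/Phi_simple.
move=> F G /asboolP[FG _]; apply: contra => /asboolP/FG Ga; exact/asboolP.
Qed.

Lemma flag_level_le Fs s : (flag_level Fs s <= size Fs)%N.
Proof. exact: count_size. Qed.

Lemma flag_matroid (Fs : seq (set V)) : positive_flag C Fs ->
  matroid_of_flag M Fs = level_matroid R C (flag_level Fs) 0 (size Fs).+1.
Proof.
move=> fFs; rewrite [in LHS](positive_flag_levels fFs).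
by apply: matroid_of_level_flag => s; exact: flag_level_le.
Qed.

Lemma flag_matroid_tubes (Fs Gs : seq (set V)) :
  positive_flag C Fs -> positive_flag C Gs ->
  matroid_of_flag M Fs = matroid_of_flag M Gs <-> flag_tubes Fs = flag_tubes Gs.
Proof.
move=> fFs fGs; rewrite !flag_matroid //.
by apply: level_matroid_tubes => s; exact: flag_level_le.
Qed.

(** If [Fs] puts [s] below [t], one of its flats separates them; this flat is also in [Hs], so [Hs]
    orders them alike. *)
Lemma flag_tubes_sub (Fs Hs : seq (set V)) : positive_flag C Fs -> positive_flag C Hs ->
  {subset Fs <= Hs} -> flag_tubes Fs \subset flag_tubes Hs.
Proof.
move=> fFs fHs FH; apply: level_tubes_coarsen => s t st.
have : Phi (lower_set (flag_level Fs) (flag_level Fs s).+1) \in Hs.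
  apply: FH; rewrite [X in _ \in X](positive_flag_levels fFs); apply: map_f.
  rewrite mem_iota /= add1n ltnS (leq_trans st) //; exact: flag_level_le.
rewrite [X in _ \in X](positive_flag_levels fHs) => /mapP[i _ /Phi_inj E].
have : s \in lower_set (flag_level Hs) i by rewrite -E in_lower_set.
have : t \notin lower_set (flag_level Hs) i by rewrite -E in_lower_set -leqNgt.
by rewrite !in_lower_set -leqNgt => it si; exact: leq_trans it.
Qed.

Lemma level_flag_positive l k : (forall s, (l s <= k)%N) -> (0 < k)%N ->
  (forall j, (j <= k)%N -> exists s, l s = j) ->
  positive_flag C [seq Phi (lower_set l i) | i <- iota 1 k].
Proof.
move=> lk k0 lonto; split.
- by case: k k0 {lk lonto}.
- have -> : set0 :: rcons [seq Phi (lower_set l i) | i <- iota 1 k] Pos =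
      [seq Phi (lower_set l i) | i <- iota 0 k.+2].
    rewrite /= Phi_lower0 -(@Phi_lower_full _ _ _ C l k.+1) // -map_rcons -cats1.
    by rewrite -[[:: k.+1]]/(iota (1 + k) 1) -iotaD addn1.
  rewrite sorted_map; apply/(sortedP 0%N) => i; rewrite size_iota => ik.
  rewrite !nth_iota ?add0n /=; [|exact: ik|exact: ltnW].
  apply/asboolP; split.
    move=> a /pos_roots_inP[Pa /fintype.subsetP ai]; apply/pos_roots_inP; split => //.
    apply/fintype.subsetP => s /ai; rewrite !in_lower_set => /ltnW.
    by rewrite -ltnS.
  have [s si] := lonto i ik; move=> /(_ (alpha s)).
  move=> h; have /h/Phi_simple : Phi (lower_set l i.+1) (alpha s).
    by apply/Phi_simple; rewrite in_lower_set si.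
  by rewrite in_lower_set si ltnn.
by move=> F /mapP[i _ ->]; apply/positive_flatP; exists (lower_set l i).
Qed.

Hypothesis e_conn : induces_connected e finset.setT.

(** A tube has an outgoing edge that climbs, so there are at least two levels and the flag is
    nonempty. The last clause serves to show that a refined flag contains the original one. *)
Lemma flag_of_level l : level_tubes e l != finset.set0 ->
  exists Hs, [/\ positive_flag C Hs, flag_tubes Hs = level_tubes e l &
    forall J : {set S}, J != finset.set0 -> J != finset.setT ->
      (forall s t, s \in J -> t \notin J -> (l s < l t)%N) -> Phi J \in Hs].
Proof.
move=> /finset.set0Pn[J /level_tubesP[/and3P[/finset.set0Pn[t tJ] JT _] Jl]].
have nJT : ~~ (finset.setT \subset J) by rewrite finset.subTset.
have [p [q [_ pJ _ qJ epq]]] :=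
  induces_connected_exit e_conn (finset.in_setT t) tJ nJT.
have pq := Jl p p q pJ pJ qJ epq.
pose r := level_rank l; pose k := \max_s r s.
have rk s : (r s <= k)%N by exact: leq_bigmax.
have k0 : (0 < k)%N.
  apply: leq_trans (rk q); apply: leq_ltn_trans (leq0n (r p)) _.
  by rewrite level_rank_lt.
have ronto j : (j <= k)%N -> exists s, r s = j.
  have S0 : (0 < #|S|)%N by apply/card_gt0P; exists p.
  have [s ks] := @mathcomp.boot.bigop.eq_bigmax S r S0.
  by rewrite /k ks => /level_rank_onto.
exists [seq Phi (lower_set r i) | i <- iota 1 k]; split.
- exact: level_flag_positive.
- rewrite /flag_tubes; apply/eqP; rewrite finset.eqEsubset; apply/andP; split;
    apply: level_tubes_coarsen => a b; rewrite !flag_level_map // level_rank_lt //.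
move=> K /finset.set0Pn[x xK] KT Kl.
have /subsetPn[y _ yK] : ~~ (finset.setT \subset K) by rewrite finset.subTset.
(* The rank of a lowest node outside [K] is the index at which [K] occurs. *)
case: (@arg_minnP _ y (fun z => z \notin K) r yK) => z zK zmin.
apply/mapP; exists (r z).
  have xz : (r x < r z)%N by rewrite level_rank_lt; exact: Kl.
  by rewrite mem_iota add1n ltnS rk andbT; exact: leq_ltn_trans xz.
congr (Phi _); apply/finset.setP => s; rewrite in_lower_set level_rank_lt.
have [sK|sK] := boolP (s \in K); first by rewrite Kl.
by apply/esym/negbTE; rewrite -leqNgt leqNgt -level_rank_lt -leqNgt; exact: zmin.
Qed.

Lemma flag_refine (Fs : seq (set V)) T : positive_flag C Fs -> nested e T ->
  flag_tubes Fs \subset T -> T != finset.set0 ->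
  exists Hs, [/\ positive_flag C Hs, flag_tubes Hs = T & {subset Fs <= Hs}].
Proof.
move=> fFs nT FT T0; have [_ Fprop] := flag_pairwise fFs.
have [l [ll' lT]] := nested_refine (diagram_sym C) e_conn nT FT.
have [|Hs [fHs HT HP]] := @flag_of_level l; first by rewrite lT.
exists Hs; split=> //; first by rewrite HT.
move=> F FFs; have [[_ nF0] [_ nFP]] := Fprop F FFs.
move: FFs nF0 nFP.
rewrite [X in _ \in X](positive_flag_levels fFs) => /mapP[i _ ->] n0 nP.
apply: HP.
- apply/negP => /eqP J0; apply: n0 => a; rewrite J0 => /pos_roots_inP[[ra _]].
  by rewrite finset.subset0 (negbTE (root_support_neq0 ra)).
- apply/negP => /eqP JT; apply: nP => a Pa; rewrite JT; apply/pos_roots_inP.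
  by split; rewrite // finset.subsetT.
by move=> s t; rewrite !in_lower_set -leqNgt => si it; apply: ll'; exact: leq_trans it.
Qed.

End FlagLevels.

(** * Facet labels of tubings *)

Section TubeFacets.
Import mathcomp.boot.fintype mathcomp.boot.finset.
Variables (S : finType) (e : rel S).

Definition tube_facets (T : {set {set S}}) : {set facet_label S} :=
  [set inr Y | Y in T].

Lemma tube_facets_sub T T' :
  (tube_facets T \subset tube_facets T') = (T \subset T').
Proof.
apply/subsetP/subsetP => [h Y YT|h x /imsetP[Y /h YT' ->]]; last exact: imset_f.
have : inr Y \in tube_facets T' by apply: h; exact: imset_f.
by move=> /imsetP[Z ZT' [->]].
Qed.

Lemma tube_facets_inj : injective tube_facets.
Proof.
move=> T T' E; apply/eqP; rewrite eqEsubset -!tube_facets_sub E.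
by rewrite subxx.
Qed.

Lemma tube_facets_eq0 T : (tube_facets T == set0) = (T == set0).
Proof. exact: imset_eq0. Qed.

Lemma connected_graphW : connected_graph e -> induces_connected e setT.
Proof.
move=> /'forall_'forall_idP h; apply/'forall_in_'forall_in_idP => s _ t _.
rewrite (@eq_connect _ _ e) ?h // => x y /=.
by rewrite !inE.
Qed.

End TubeFacets.

(** * Coarse cells and their closures *)

Section Cells.
Variables (R : realType) (W : groupType) (S : finType) (C : coxeter_system W S).
Local Open Scope classical_set_scope.
Local Open Scope ring_scope.

Local Notation V := (root_space R S).
Local Notation e := (diagram C).
Local Notation Pos := (@pos_roots R W S C).
Local Notation Phi := (@pos_roots_in R W S C).
Local Notation M := (root_matroid R C).
Local Notation flag := (@positive_flag R W S C).

Definition barycenter (Fs : seq (set V)) : bergman_space R S :=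
  fun F => if F \in Fs then (size Fs)%:R^-1 else 0.

Lemma barycenterP Fs : flag Fs -> open_simplex Fs (barycenter Fs).
Proof.
move=> fFs; have [Fs0 _ _] := fFs.
have s0 : 0 < (size Fs)%:R :> R by rewrite ltr0n lt0n size_eq0; exact/eqP.
split=> [F FFs|F FFs|]; rewrite /barycenter ?FFs ?invr_gt0 //.
  by rewrite (negbTE FFs).
under eq_big_seq do rewrite ifT //.
by rewrite big_const_seq count_predT iter_addr addr0 -[LHS]mulr_natr mulVf ?gt_eqF.
Qed.

Lemma nbhs_positive (x : bergman_space R S) (Fs : seq (set V)) :
  (forall F, F \in Fs -> 0 < x F) ->
  nbhs x [set y : bergman_space R S | forall F, F \in Fs -> 0 < y F].
Proof.
elim: Fs => [|F Fs IH] xFs.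
  by apply: filterS filterT => y _ F; rewrite in_nil.
have xF : 0 < x F by apply: xFs; rewrite mem_head.
have nF : nbhs x [set y : bergman_space R S | 0 < y F].
  have h := @proj_continuous (set V) (fun _ : set V => R) F x.
  apply: (h [set r | 0 < r]).
  by apply: open_nbhs_nbhs; split; [exact: open_gt|].
have nFs : nbhs x [set y : bergman_space R S | forall G, G \in Fs -> 0 < y G].
  by apply: IH => G GFs; apply: xFs; rewrite inE GFs orbT.
apply: filterS (filterI nF nFs) => y [yF yFs] G; rewrite inE => /orP[/eqP->//|].
exact: yFs.
Qed.

Lemma sum_subflag (x : set V -> R) (Gs Hs : seq (set V)) : uniq Gs -> uniq Hs ->
  {subset Gs <= Hs} -> (forall F, F \notin Gs -> x F = 0) ->
  \sum_(F <- Hs) x F = \sum_(F <- Gs) x F.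
Proof.
move=> uG uH GH x0; rewrite (bigID (mem Gs)) /= [X in _ + X]big1 ?addr0 //.
rewrite -big_filter; apply: perm_big; apply: uniq_perm; rewrite ?filter_uniq //.
by move=> F; rewrite mem_filter; case: (boolP (F \in Gs)) => // /GH ->.
Qed.

Lemma closure_open_simplex Gs Hs : flag Gs -> flag Hs -> {subset Gs <= Hs} ->
  open_simplex Gs `<=` closure (open_simplex Hs : set (bergman_space R S)).
Proof.
move=> fG fH GH x [xpos x0 xsum] U xU.
have [bpos b0 bsum] := barycenterP fH; set b := barycenter Hs in bpos b0 bsum.
have x_ge0 F : 0 <= x F.
  by have [/xpos/ltW//|/x0->] := boolP (F \in Gs).
(* Segment from [x] towards the barycenter of [Hs]; for [0 < t < 1] it stays in the open simplex of
   [Hs]. *)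
pose y (t : R) : bergman_space R S := fun F => (1 - t) * x F + t * b F.
have ycvg : y t @[t --> (0 : R)] --> (x : bergman_space R S).
  have FF : Filter (y t @[t --> (0 : R)]) by exact: fmap_filter.
  apply/cvg_sup => F; rewrite cvg_image; last first.
    by rewrite eqEsubset; split=> v // _; exists (fun=> v).
  move=> A; rewrite nbhs_simpl /= => xA.
  exists ((fun g : set V -> R => g F) @^-1` A).
    have : (1 - t) * x F + t * b F @[t --> (0 : R)] --> x F.
      rewrite -[X in _ --> X](_ : (1 - 0) * x F + 0 * b F = x F); last first.
        by rewrite subr0 mul1r mul0r addr0.
      apply: cvgD; apply: cvgM; try exact: cvg_cst; last exact: cvg_id.
      by apply: cvgB; [exact: cvg_cst|exact: cvg_id].
    by apply.
  by rewrite eqEsubset; split => [j [? + <-//]|j Aj]; exists (fun=> j).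
have yU : \forall t \near (0 : R), U (y t) by exact: ycvg.
have yU' : \forall t \near (0 : R)^'+, U (y t) by exact: cvg_within.
near (0 : R)^'+ => t.
have t0 : 0 < t by near: t; exact: nbhs_right_gt.
have t1 : t < 1 by near: t; exact: nbhs_right_lt.
exists (y t); split; last by near: t.
split=> [F FH|F FH|].
- by rewrite ltr_wpDl ?mulr_ge0 ?mulr_gt0 ?bpos // subr_ge0 ltW.
- rewrite /y x0 ?b0 ?mulr0 ?addr0 //.
  by apply: contra FH; exact: GH.
- rewrite /y big_split /= -!mulr_sumr bsum.
  rewrite (sum_subflag (flag_uniq fG) (flag_uniq fH) GH x0) xsum.
  by rewrite !mulr1 subrK.
Unshelve. all: by end_near.
Qed.

Lemma flag_level_gap (Fs : seq (set V)) : flag Fs ->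
  exists s t, (flag_level Fs s < flag_level Fs t)%N.
Proof.
move=> fFs; have [Fs0 _ _] := fFs; have [_ Fprop] := flag_pairwise fFs.
have [F FFs] : exists F, F \in Fs.
  by case: Fs Fs0 {fFs Fprop} => // F ? _; exists F; rewrite mem_head.
have [[_ F0] [_ FP]] := Fprop F FFs; move: FFs F0 FP.
rewrite [X in _ \in X](positive_flag_levels fFs) => /mapP[i _ ->] F0 FP.
have [s si] : exists s, (flag_level Fs s < i)%N.
  apply: contrapT => h; apply: F0 => a /pos_roots_inP[[ra _] /fintype.subsetP ai].
  have /finset.set0Pn[s /ai] := root_support_neq0 ra; rewrite in_lower_set => si.
  by apply: h; exists s.
have [t ti] : exists t, (i <= flag_level Fs t)%N.
  apply: contrapT => h; apply: FP => a Pa; apply/pos_roots_inP; split => //.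
  apply/fintype.subsetP => t _; rewrite in_lower_set ltnNge; apply/negP => it.
  by apply: h; exists t.
by exists s, t; exact: leq_trans ti.
Qed.

Lemma flag_tubes_neq0 (Fs : seq (set V)) : flag Fs ->
  flag_tubes C Fs != finset.set0.
Proof.
move=> /flag_level_gap[s [t st]]; apply/finset.set0Pn.
exists (level_component e (flag_level Fs) s).
exact: level_component_tube_lt (diagram_sym C) _ _ _ st.
Qed.

Hypothesis e_conn : induces_connected e finset.setT.

Lemma flag_tubes_nested (Fs : seq (set V)) : flag Fs -> nested e (flag_tubes C Fs).
Proof.
move=> /flag_level_gap[s _]; exact: (level_tubes_nested (diagram_sym C) e_conn s).
Qed.

Lemma open_simplex_cell (Fs Gs : seq (set V)) : flag Fs -> flag Gs ->
  flag_tubes C Gs = flag_tubes C Fs -> open_simplex Gs `<=` coarse_cell C Fs.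
Proof.
move=> fF fG GF x xG; exists Gs => //; split => //.
exact/(flag_matroid_tubes fG fF).
Qed.

(** Points near the barycenter of [Fs] are positive on all of [Fs], so one of them in the cell of
    [Gs] lies in the simplex of a flag containing [Fs]. Conversely, every flag in the cell of [Fs]
    is refined to one with the tubes of [Gs], whose simplex has the given one in its closure. *)
Lemma coarse_cell_leP (Fs Gs : seq (set V)) : flag Fs -> flag Gs ->
  coarse_le (coarse_cell C Fs) (coarse_cell C Gs) <->
  flag_tubes C Fs \subset flag_tubes C Gs.
Proof.
move=> fF fG; split => [FG|FG x [Fs' [fF' /(flag_matroid_tubes fF' fF) FE] xF']].
  have bF : coarse_cell C Fs (barycenter Fs).
    exact: (open_simplex_cell fF fF erefl (barycenterP fF)).
  have [pos _ _] := barycenterP fF.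
  have [y [[Hs [fH /(flag_matroid_tubes fH fG) HG] [_ y0 _]] ypos]] :=
    FG _ bF _ (nbhs_positive pos).
  rewrite -HG; apply: flag_tubes_sub => // F /ypos yF.
  by apply: contraT => /y0 yF0; rewrite yF0 ltxx in yF.
have [|Hs [fH HT F'H]] :=
  flag_refine e_conn fF' (flag_tubes_nested fG) _ (flag_tubes_neq0 fG).
  by rewrite FE.
apply: (closureS (open_simplex_cell fG fH HT)).
exact: closure_open_simplex xF'.
Qed.

Lemma coarse_cell_tubes (Fs Gs : seq (set V)) : flag Fs -> flag Gs ->
  coarse_cell C Fs = coarse_cell C Gs <-> flag_tubes C Fs = flag_tubes C Gs.
Proof.
move=> fF fG; split => [E|/(flag_matroid_tubes fF fG) E].
  apply/eqP; rewrite finset.eqEsubset; apply/andP; split.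
    by apply/(coarse_cell_leP fF fG); rewrite E => x xG U /nbhs_singleton; exists x.
  by apply/(coarse_cell_leP fG fF); rewrite E => x xG U /nbhs_singleton; exists x.
by rewrite /coarse_cell E.
Qed.

(** A chosen flag of the cell; the default never occurs on [coarse_cells]. By [coarse_cell_tubes]
    its tubing does not depend on the choice. *)
Definition cell_flag (c : set (bergman_space R S)) : seq (set V) :=
  xget [::] [set Fs | flag Fs /\ coarse_cell C Fs = c].

Lemma cell_flagP (c : set (bergman_space R S)) : coarse_cells C c ->
  flag (cell_flag c) /\ coarse_cell C (cell_flag c) = c.
Proof.
move=> [Fs fF cE].
have ex : exists Gs, [set Gs | flag Gs /\ coarse_cell C Gs = c] Gs by exists Fs.
exact: (xgetPex [::] ex).
Qed.

End Cells.
Theorem theorem1 (R : realType) (W : groupType) (S : finType)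
    (C : coxeter_system W S) (irr : connected_graph (diagram C)) :
  anti_isomorphic (@coarse_cells R W S C) (@coarse_le R S)
    (proper_faces (graph_associahedron (diagram C)))
    (@face_le (facet_label S)).
Proof.
have e_conn := connected_graphW irr; have e_sym := diagram_sym C.
exists (fun c => tube_facets (flag_tubes C (cell_flag C c))); split; last first.
  move=> c d /cell_flagP[fc cE] /cell_flagP[fd dE].
  rewrite -{1}cE -{1}dE /face_le tube_facets_sub.
  exact: (coarse_cell_leP e_conn fc fd).
split.
- move=> c /cell_flagP[fc _]; split.
    apply/(graph_associahedronP e_sym e_conn).
    by exists (flag_tubes C (cell_flag C c)) => //; exact: flag_tubes_nested.
  by rewrite tube_facets_eq0; exact: flag_tubes_neq0.
- move=> c d /set_mem/cell_flagP[fc cE] /set_mem/cell_flagP[fd dE] /tube_facets_inj.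
  by move=> /(coarse_cell_tubes e_conn fc fd); rewrite cE dE.
- move=> A [/(graph_associahedronP e_sym e_conn)[T nT ->]].
  rewrite -/(tube_facets T) tube_facets_eq0 => T0.
  have [l lT] := nested_level_tubes e_sym e_conn nT.
  have [|Hs [fH HT _]] := @flag_of_level R W S C e_conn l; first by rewrite lT.
  have cH : coarse_cells C (coarse_cell C Hs) by exists Hs.
  exists (coarse_cell C Hs) => //.
  have [fH' /(coarse_cell_tubes e_conn fH' fH) ->] := cell_flagP cH.
  by rewrite HT lT.
Qed.
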